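(* Let $n\ge1$ and let $\{\mathbf{s}_1,\dots,\mathbf{s}_M\}\subset\mathbb{R}^n$ be any constellation of $M\ge2$ distinct points, used over the AWGN channel with maximum-likelihood detection. Fix $i$. As a function of the noise power $P_N=\sigma_0^2>0$, $P_{ei}$ has the following properties: (1) $P_{ei}$ is concave on the range $P_N\ge\dfrac{d_{\max,i}^2}{n+2-\sqrt{2(n+2)}}$. (2) $P_{ei}$ is convex on the range $P_N\le\dfrac{d_{\min,i}^2}{n+2+\sqrt{2(n+2)}}$. (3) There is an odd number of inflection points of $P_{ei}$ in the range $$\frac{d_{\min,i}^2}{n+2+\sqrt{2(n+2)}}\le P_N\le\frac{d_{\max,i}^2}{n+2-\sqrt{2(n+2)}} .$$
   Context: Setting: a constellation is a set of $M\ge2$ distinct points $\mathbf{s}_1,\dots,\mathbf{s}_M\in\mathbb{R}^n$, normalized by $\frac1M\sum_{i=1}^M|\mathbf{s}_i|^2=1$ ($|\cdot|$ is the Euclidean norm). The received vector is $\mathbf{r}=\mathbf{s}+\boldsymbol{\xi}$, $\mathbf{s}$ a constellation point, $\boldsymbol\xi\sim\mathcal N(\mathbf 0,\sigma_0^2\mathbf I)$, and the maximum-likelihood detector outputs $\hat{\mathbf{s}}=\arg\min_{\mathbf{s}_i}|\mathbf{r}-\mathbf{s}_i|$. The noise power is $P_N=\sigma_0^2$. The decision region of $\mathbf{s}_i$, with the origin shifted to $\mathbf{s}_i$, is the convex polyhedron $\Omega_i=\{\mathbf{x}\in\mathbb{R}^n:\ \mathbf{a}_j^T\mathbf{x}\le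 b_j\ \ \forall j\ne i\}$ with $\mathbf{a}_j=(\mathbf{s}_j-\mathbf{s}_i)/|\mathbf{s}_j-\mathbf{s}_i|$, $b_j=\frac12|\mathbf{s}_j-\mathbf{s}_i|$. The error probability given $\mathbf{s}=\mathbf{s}_i$ is $P_{ei}=1-P_{ci}$, $P_{ci}(P_N)=\int_{\Omega_i}(2\pi P_N)^{-n/2}e^{-|\mathbf{x}|^2/(2P_N)}\,d\mathbf{x}$. $d_{\min,i}=\min_{j\ne i} b_j$ is the minimum, and $d_{\max,i}$ the maximum, distance from the origin to the boundary of $\Omega_i$; $d_{\max,i}=\infty$ if $\Omega_i$ is unbounded, in which case the range in (1) is empty and the range in (3) is unbounded above. An inflection point is a zero of the second derivative in $P_N$ at which it changes sign. *)

(* Defs.v *)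
From HB Require Import structures.
From mathcomp Require Import all_boot all_order all_algebra.
From mathcomp Require Import all_classical all_reals all_analysis.

Set Implicit Arguments.
Unset Strict Implicit.
Unset Printing Implicit Defensive.

Import Order.TTheory GRing.Theory Num.Theory.
Import numFieldNormedType.Exports.

Local Open Scope classical_set_scope.
Local Open Scope ring_scope.

Definition rV_display : measure_display.
Proof. exact: default_measure_display. Qed.

Section measurable_rV.
Context {R : realType} (n : nat).

Definition rV_coord (i : 'I_n) (x : 'rV[R]_n) : measurableTypeR R := x 0 i.

Let rV_set0 : g_sigma_preimage rV_coord set0.
Proof. exact: sigma_algebra0. Qed.

Let rV_setC A : g_sigma_preimage rV_coord A -> g_sigma_preimage rV_coord (~` A).
Proof. exact: sigma_algebraC. Qed.

Let rV_bigcup (F : _^nat) : (forall i, g_sigma_preimage rV_coord (F i)) ->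
  g_sigma_preimage rV_coord (\bigcup_i (F i)).
Proof. exact: sigma_algebra_bigcup. Qed.

(* The product sigma-algebra, i.e. the Borel sigma-algebra of R^n. *)
HB.instance Definition _ := @isMeasurable.Build rV_display
  'rV[R]_n (g_sigma_preimage rV_coord) rV_set0 rV_setC rV_bigcup.

Lemma measurable_rV_coord i : measurable_fun [set: 'rV[R]_n] (rV_coord i).
Proof.
move=> _ Y mY; rewrite setTI; apply: sub_sigma_algebra => /=.
rewrite -bigcup_seq/=; exists i => /=; first by rewrite mem_index_enum.
by exists Y => //; rewrite setTI.
Qed.

Lemma measurable_fun_rVP d (T : measurableType d) (f : T -> 'rV[R]_n) :
  (forall i, measurable_fun [set: T] (rV_coord i \o f)) ->
  measurable_fun [set: T] f.
Proof.
move=> mf.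
have : @g_sigma_preimage _ (measurableTypeR R) _ _ (fun i => rV_coord i \o f)
    `<=` measurable.
  apply: smallest_sub; first exact: sigma_algebra_measurable.
  rewrite -bigcup_seq/=; apply: bigcup_sub => i _.
  by move=> A [B mB <-]; exact: mf.
rewrite g_sigma_preimage_comp => sub _ A mA.
by rewrite setTI; apply: sub; exists A => //; rewrite setTI.
Qed.

End measurable_rV.

Section cons_rV.
Context {R : realType} (n : nat).

Definition cons_rV (p : measurableTypeR R * 'rV[R]_n) : 'rV[R]_n.+1 :=
  \row_i (if unlift ord0 i is Some j then p.2 0 j else p.1).

Definition uncons_rV (x : 'rV[R]_n.+1) : measurableTypeR R * 'rV[R]_n :=
  (x 0 ord0, \row_j x 0 (lift ord0 j)).

Lemma cons_rVK : cancel cons_rV uncons_rV.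
Proof.
move=> [a x]; rewrite /uncons_rV /cons_rV !mxE unlift_none/=; congr pair.
by apply/rowP => j; rewrite !mxE liftK.
Qed.

Lemma uncons_rVK : cancel uncons_rV cons_rV.
Proof.
move=> x; apply/rowP => i; rewrite !mxE.
by case: unliftP => [j ->|->]; rewrite ?mxE.
Qed.

Lemma measurable_cons_rV : measurable_fun [set: _] cons_rV.
Proof.
apply: measurable_fun_rVP => i.
case: (unliftP ord0 i) => [j ->|->].
  rewrite (_ : _ \o _ = rV_coord j \o snd).
    by apply: measurableT_comp; [exact: measurable_rV_coord|].
  by apply/funext => p; rewrite /= /rV_coord mxE liftK.
rewrite (_ : _ \o _ = fst)//.
by apply/funext => p; rewrite /= /rV_coord mxE unlift_none.
Qed.

Lemma measurable_uncons_rV : measurable_fun [set: _] uncons_rV.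
Proof.
apply/measurable_fun_pairP; split; first exact: (measurable_rV_coord ord0).
apply: measurable_fun_rVP => j.
rewrite (_ : _ \o _ = rV_coord (lift ord0 j)); first exact: measurable_rV_coord.
by apply/funext => x; rewrite /= /rV_coord mxE.
Qed.

End cons_rV.

Section lebesgue_rV_step.
Context {R : realType} (n : nat) (m : {sigma_finite_measure set 'rV[R]_n -> \bar R}).
Local Open Scope ereal_scope.

Definition cons_measure : set 'rV[R]_n.+1 -> \bar R :=
  pushforward (@lebesgue_measure R \x m) (@cons_rV R n).

Let cons_measure0 : cons_measure set0 = 0.
Proof. by rewrite /cons_measure /pushforward preimage_set0 measure0. Qed.

Let cons_measure_ge0 A : 0 <= cons_measure A.
Proof. by rewrite /cons_measure /pushforward measure_ge0. Qed.

Let cons_measure_sigma_additive : semi_sigma_additive cons_measure.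
Proof.
move=> F mF tF mUF; rewrite /cons_measure /pushforward preimage_bigcup.
have mcons A : measurable A -> measurable (@cons_rV R n @^-1` A).
  by move=> mA; rewrite -[X in measurable X]setTI; exact: measurable_cons_rV.
apply: measure_semi_sigma_additive.
- by move=> k; exact: mcons.
- apply/trivIsetP => /= i j _ _ ij; rewrite -preimage_setI.
  by move/trivIsetP : tF => /(_ _ _ _ _ ij) ->//; rewrite preimage_set0.
- by rewrite -preimage_bigcup; exact: mcons.
Qed.

HB.instance Definition _ := isMeasure.Build _ _ _ cons_measure
  cons_measure0 cons_measure_ge0 cons_measure_sigma_additive.

Let cons_measure_sigma_finite : sigma_finite setT cons_measure.
Proof.
have /sigma_finiteP[F [TF ndF Foo]] := sigma_finiteT (@lebesgue_measure R).
have /sigma_finiteP[G [TG ndG Goo]] := sigma_finiteT m.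
exists (fun k => @uncons_rV R n @^-1` (F k `*` G k)).
  apply/esym; rewrite -subTset => x _.
  have [k _ Fk] : (\bigcup_k F k) (uncons_rV x).1 by rewrite -TF.
  have [l _ Gl] : (\bigcup_k G k) (uncons_rV x).2 by rewrite -TG.
  exists (maxn k l) => //; split.
  - by move: Fk; exact/subsetPset/ndF/leq_maxl.
  - by move: Gl; exact/subsetPset/ndG/leq_maxr.
move=> k; have [mF Fk] := Foo k; have [mG Gk] := Goo k; split.
  rewrite -[X in measurable X]setTI; apply: measurable_uncons_rV => //.
  exact: measurableX.
rewrite /cons_measure /pushforward -comp_preimage.
rewrite (_ : _ \o _ = id); last by apply/funext => p; exact: cons_rVK.
by rewrite preimage_id product_measure1E// lte_mul_pinfty// ge0_fin_numE.
Qed.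

HB.instance Definition _ := Measure_isSigmaFinite.Build _ _ _ cons_measure
  cons_measure_sigma_finite.

End lebesgue_rV_step.

Fixpoint lebesgue_rV {R : realType} (n : nat) :
    {sigma_finite_measure set 'rV[R]_n -> \bar R} :=
  match n with
  | 0 => dirac (0 : 'rV[R]_0)
  | n'.+1 => cons_measure (lebesgue_rV n')
  end.

(* Characterizes [lebesgue_rV]: boxes have the product of the side measures. *)
Lemma lebesgue_rV_box (R : realType) (n : nat) (A : 'I_n -> set R) :
  (forall i, measurable (A i : set (measurableTypeR R))) ->
  lebesgue_rV n [set x : 'rV[R]_n | forall i, A i (x 0 i)] =
  (\prod_(i < n) lebesgue_measure (A i))%E.
Proof.
elim: n A => [|n IH] A mA /=.
  rewrite big_ord0 diracE mem_set//=; first by case.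
rewrite /cons_measure /pushforward big_ord_recl -IH; last by move=> i; exact: mA.
rewrite -product_measure1E//; last first.
  rewrite (_ : mkset _ = \bigcap_(i in [set: 'I_n])
    (rV_coord i @^-1` A (lift ord0 i))).
    apply: fin_bigcap_measurable => [|i _]; first exact: finite_finset.
    by rewrite -[X in measurable X]setTI; apply: measurable_rV_coord.
  by apply/seteqP; split => x /= Ax i; [move=> _|]; exact: Ax.
congr (_ _); apply/seteqP; split => [[a x] /= Ax|[a x] /= [Aa Ax] i].
  split; first by have := Ax ord0; rewrite mxE unlift_none.
  by move=> i; have := Ax (lift ord0 i); rewrite mxE liftK.
by rewrite mxE; case: unliftP => [j ->|->].
Qed.

Section constellation.
Context {R : realType} {n M : nat}.
Implicit Types (x y : 'rV[R]_n) (s : 'I_M -> 'rV[R]_n) (i j : 'I_M).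

Definition dot x y : R := \sum_(k < n) x 0 k * y 0 k.

(* The library norm [`|x|] on row vectors is the sup norm. *)
Definition enorm x : R := Num.sqrt (dot x x).

Definition constellation s :=
  [/\ (2 <= M)%N, injective s & M%:R^-1 * \sum_(i < M) enorm (s i) ^+ 2 = 1].

Definition facet_normal s i j : 'rV[R]_n :=
  (enorm (s j - s i))^-1 *: (s j - s i).

Definition facet_dist s i j : R := 2^-1 * enorm (s j - s i).

Definition decision_region s i : set 'rV[R]_n :=
  [set x | forall j, j != i -> dot (facet_normal s i j) x <= facet_dist s i j].

Definition gauss_density (P : R) x : R :=
  (2 * pi * P) `^ (- (n%:R / 2)) * expR (- (enorm x ^+ 2 / (2 * P))).

(* Both functions of the noise power [P] are meaningful for [0 < P] only. *)
Definition correct_prob s i (P : R) : R :=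
  \int[lebesgue_rV n]_(x in decision_region s i) gauss_density P x.

Definition error_prob s i (P : R) : R := 1 - correct_prob s i P.

(* The infimum ranges over a finite set, nonempty when [2 <= M]. *)
Definition dmin s i : R := inf [set facet_dist s i j | j in [set j | j != i]].

Definition boundary (A : set 'rV[R]_n) := closure A `\` A°.

Definition dmax s i : \bar R :=
  if `[< bounded_set (decision_region s i) >]
  then ereal_sup [set (enorm x)%:E | x in boundary (decision_region s i)]
  else +oo%E.

Definition lower_threshold s i : R :=
  dmin s i ^+ 2 / (n%:R + 2 + Num.sqrt (2 * (n%:R + 2))).

Definition upper_threshold s i : \bar R :=
  (dmax s i ^+ 2 * ((n%:R + 2 - Num.sqrt (2 * (n%:R + 2)))^-1)%:E)%E.

End constellation.

Section real_functions.
Context {R : realType}.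
Implicit Types (f : R -> R) (D : set R).

Definition convex_on D f := @convex_function R R^o D f.

Definition concave_on D f := convex_on D (\- f).

(* [derive1n] is a total operator, with unspecified values where derivatives do
   not exist; hence the first clause. *)
Definition inflection_point f (p : R) :=
  [/\ \forall q \near p, derivable f q 1 /\ derivable (derive1 f) q 1,
      derive1n 2 f p = 0 &
      ((\forall q \near p^'-, derive1n 2 f q < 0) /\
       (\forall q \near p^'+, 0 < derive1n 2 f q)) \/
      ((\forall q \near p^'-, 0 < derive1n 2 f q) /\
       (\forall q \near p^'+, derive1n 2 f q < 0))].

Definition odd_card D := exists2 k : nat, odd k & (D #= `I_k)%card.

End real_functions.

(* Main.v *)
Require Import Defs.
From mathcomp Require Import all_boot all_order all_algebra.
From mathcomp Require Import all_classical all_reals all_analysis.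
From mathcomp Require Import ring lra.
From mathcomp Require Import measurable_realfun.

Set Implicit Arguments.
Unset Strict Implicit.
Unset Printing Implicit Defensive.

Import Order.TTheory GRing.Theory Num.Theory.
Import numFieldNormedType.Exports.

Local Open Scope classical_set_scope.
Local Open Scope ring_scope.

(* P_ci'' is an integral over Omega_i of (r^2 - (n+2-q) P) (r^2 - (n+2+q) P) times
   a positive density, with q = sqrt (2 (n+2)). Hence (1) by the sign of the
   kernel on Omega_i, and (2) by its sign on the complement, the integral over R^n
   being 0. For (3), P_ei'' is, up to a positive factor, a real-analytic function
   of 1/(2P), so its zeros are isolated; it is > 0 at the lower threshold, and
   the number of its sign changes is odd as soon as it is <= 0 for large P.

   When Omega_i is unbounded the latter does not follow from the kernel. Write
   P = t^-2; then P_ci is a constant times the Gaussian mass A(t) of t Omega_i.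
   Cut R^n into the cones over the facets of Omega_i. If q is a point of a facet,
   the shell of its cone between levels a and b is mapped by the translation by
   d q into the shell between a+d and b+d, while the homothety of ratio 1/2 and
   centre a q maps it into itself, which bounds its second moment by its mass.
   So each shell loses at most a proportion C d of its mass, i.e.
   A'(a+d) >= (1 - C d) A'(a), and t^3 A'(t) = -2 P_ci'(t^-2) times a constant is
   nondecreasing for small t. *)

(** * Real functions *)

Section pointwise_derivatives.
Context {R : realType}.
Implicit Types (f g : R -> R) (x c df dg : R).

Lemma is_derive1D f g x df dg : is_derive x 1 f df -> is_derive x 1 g dg ->
  is_derive x 1 (fun u => f u + g u) (df + dg).
Proof. by move=> ? ?; exact: (is_deriveD (f := f)). Qed.

Lemma is_derive1M f g x df dg : is_derive x 1 f df -> is_derive x 1 g dg ->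
  is_derive x 1 (fun u => f u * g u) (df * g x + f x * dg).
Proof.
move=> Df Dg; apply: (is_derive_eq (@is_deriveM _ _ f g x 1 df dg Df Dg)).
by rewrite /GRing.scale/= addrC mulrC.
Qed.

Lemma is_derive1Z f c x df : is_derive x 1 f df ->
  is_derive x 1 (fun u => c * f u) (c * df).
Proof. by move=> ?; exact: (is_deriveZ (f := f)). Qed.

Lemma is_derive1V f x df : f x != 0 -> is_derive x 1 f df ->
  is_derive x 1 (fun u => (f u)^-1) (- (f x ^- 2 * df)).
Proof.
move=> fx0 Df; apply: (is_derive_eq (@is_deriveV _ f x df 1 fx0 Df)).
by rewrite /GRing.scale/= mulNr.
Qed.

Lemma is_derive1_expR f x df : is_derive x 1 f df ->
  is_derive x 1 (fun u => expR (f u)) (expR (f x) * df).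
Proof. by move=> ?; exact: (@is_derive1_comp _ expR f). Qed.

Lemma is_derive_continuous f x df : is_derive x 1 f df -> {for x, continuous f}.
Proof. by case=> df1 _; apply: differentiable_continuous; exact/derivable1_diffP. Qed.

End pointwise_derivatives.

Section derivative_comparison.
Context {R : realType}.

(** Only right difference quotients are compared. The two base points may differ, so an inequality
    between increments at translated points turns into one between the derivatives there. *)
Lemma is_derive_le (f g : R -> R) (x y df dg e : R) : 0 < e ->
  is_derive x 1 f df -> is_derive y 1 g dg ->
  (forall h, 0 < h < e -> f (x + h) - f x <= g (y + h) - g y) -> df <= dg.
Proof.
move=> e0 [Df <-] [Dg <-] fg.
have cf : h^-1 *: (f (h *: 1 + x) - f x) @[h --> 0^'+] --> 'D_1 f x.
  by apply: cvg_trans Df; apply: cvg_app; apply: within_subset => h h0; rewrite gt_eqF.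
have cg : h^-1 *: (g (h *: 1 + y) - g y) @[h --> 0^'+] --> 'D_1 g y.
  by apply: cvg_trans Dg; apply: cvg_app; apply: within_subset => h h0; rewrite gt_eqF.
apply: (ler_cvg_to cf cg); near=> h.
have h0 : 0 < h by near: h; exact: nbhs_right_gt.
rewrite /GRing.scale/= mulr1 ler_wpM2l ?invr_ge0 ?(ltW h0)// ![h + _]addrC.
by apply: fg; rewrite h0/=; near: h; exact: nbhs_right_lt.
Unshelve. all: by end_near. Qed.

End derivative_comparison.

(** * Convexity from the sign of the second derivative *)

Section convexity.
Context {R : realType}.
Implicit Types (f g : R -> R) (a b c x y z : R).

Lemma MVT_derive f g a b : a < b ->
  (forall x, a <= x <= b -> is_derive x 1 f (g x)) ->
  exists2 c, a < c < b & f b - f a = g c * (b - a).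
Proof.
move=> ab df.
have [c] : exists2 c, c \in `]a, b[ & f b - f a = g c * (b - a).
  apply: MVT => // [x|].
    by rewrite in_itv/= => /andP[ax xb]; apply: df; rewrite !ltW.
  by apply: derivable_within_continuous => x; rewrite in_itv/= => /df [].
by rewrite in_itv/= => cab ->; exists c.
Qed.

(** [D] is any order-convex set, so that rays, segments and the empty set are covered at once. By
    the mean value theorem [f1] is nondecreasing; two more applications, on either side of [z],
    compare the slopes of the two halves of a chord. *)
Lemma convex_on_derive2_ge0 (D : set R) (f f1 f2 : R -> R) :
  (forall x y z, D x -> D y -> x <= z <= y -> D z) ->
  (forall x, D x -> is_derive x 1 f (f1 x)) ->
  (forall x, D x -> is_derive x 1 f1 (f2 x)) ->
  (forall x, D x -> 0 <= f2 x) -> convex_on D f.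
Proof.
move=> iD df df1 f2_ge0.
have f1_ndecr a b : D a -> D b -> a < b -> f1 a <= f1 b.
  move=> Da Db ab; rewrite -subr_ge0.
  have [x /andP[ax xb]|c /andP[ac cb] ->] := @MVT_derive f1 f2 _ _ ab _.
    by apply: df1; apply: iD Da Db _; rewrite ax xb.
  by rewrite mulr_ge0 ?subr_ge0 ?(ltW ab)// f2_ge0//; apply: iD Da Db _; rewrite !ltW.
(* The chord inequality, with the denominator [b - a] cleared. *)
have chord a b z : D a -> D b -> a < z < b ->
    (b - a) * f z <= (b - z) * f a + (z - a) * f b.
  move=> Da Db /andP[az zb].
  have Dz : D z by apply: iD Da Db _; rewrite !ltW.
  have [x /andP[ax xz]|c1 /andP[ac1 c1z] E1] := @MVT_derive f f1 _ _ az _.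
    by apply: df; apply: iD Da Dz _; rewrite ax xz.
  have [x /andP[ax xz]|c2 /andP[zc2 c2b] E2] := @MVT_derive f f1 _ _ zb _.
    by apply: df; apply: iD Dz Db _; rewrite ax xz.
  have c12 : f1 c1 <= f1 c2.
    apply: f1_ndecr; last exact: lt_trans zc2.
      by apply: iD Da Dz _; rewrite !ltW.
    by apply: iD Dz Db _; rewrite !ltW.
  have -> : f b = f z + f1 c2 * (b - z) by rewrite -E2 addrC subrK.
  have -> : f a = f z - f1 c1 * (z - a) by rewrite -E1 opprB addrC subrK.
  have : 0 <= (b - z) * (z - a) * (f1 c2 - f1 c1).
    by rewrite !mulr_ge0// subr_ge0// ltW.
  by lra.
move=> t x y; rewrite !inE => Dx Dy; rewrite !convRE.
have -> : conv t x y = t%:num * x + unstable.onem t%:num * y := convRE x y t.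
rewrite /unstable.onem.
have /andP[] : 0 <= t%:num <= 1 by rewrite ge0 le1.
set k := t%:num; rewrite le_eqVlt => /predU1P[<- _|k0].
  by rewrite !mul0r !subr0 !mul1r !add0r.
rewrite le_eqVlt => /predU1P[->|k1]; first by rewrite !mul1r subrr !mul0r !addr0.
have [xy|yx|->] := ltgtP x y; last by rewrite -!mulrDl addrC subrK !mul1r.
- have xz : 0 < (1 - k) * (y - x) by rewrite mulr_gt0 ?subr_gt0.
  have zy : 0 < k * (y - x) by rewrite mulr_gt0 ?subr_gt0.
  have /(chord _ _ _ Dx Dy) : x < k * x + (1 - k) * y < y by lra.
  have -> : (y - (k * x + (1 - k) * y)) = (y - x) * k by ring.
  have -> : (k * x + (1 - k) * y - x) = (y - x) * (1 - k) by ring.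
  by rewrite -!mulrA -mulrDr ler_pM2l// subr_gt0.
- have xz : 0 < (1 - k) * (x - y) by rewrite mulr_gt0 ?subr_gt0.
  have zy : 0 < k * (x - y) by rewrite mulr_gt0 ?subr_gt0.
  have /(chord _ _ _ Dy Dx) : y < k * x + (1 - k) * y < x by lra.
  have -> : (x - (k * x + (1 - k) * y)) = (x - y) * (1 - k) by ring.
  have -> : (k * x + (1 - k) * y - y) = (x - y) * k by ring.
  by rewrite -!mulrA -mulrDr ler_pM2l ?subr_gt0// [leRHS]addrC.
Qed.

End convexity.

(** * Isolated zeros of power series *)

Section isolated_zeros.
Context {R : realType}.

(** Near 0 the first nonzero term [a m * h ^+ m] dominates the rest of the series, so [F] has no
    zero close to 0 except possibly 0 itself. *)
Lemma power_series_isolated_zero (a : R^nat) (F : R -> R) (r : R) : 0 < r ->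
  (forall h, `|h| < r -> series (fun k => a k * h ^+ k) @ \oo --> F h) ->
  (forall k, a k = 0) \/
  (exists2 d, 0 < d & forall h, 0 < `|h| < d -> F h != 0).
Proof.
move=> r0 cvgF; have [|/existsNP[k0 /eqP ak0]] := pselect (forall k, a k = 0).
  by left.
right; have [m am min_m] := ex_minnP (ex_intro (fun k => a k != 0) k0 ak0).
have a0 k : (k < m)%N -> a k = 0.
  by move=> km; apply/eqP; apply: contraTT km; rewrite -leqNgt => /min_m.
pose q := r / 2; have q0 : 0 < q by rewrite divr_gt0.
(* Convergence at [q], strictly inside the disc, bounds the terms there; the tail at [h] is then
   dominated by a geometric series of ratio [|h| / q]. *)
have [B B0 aB] : exists2 B, 0 < B & forall k, `|a k * q ^+ k| <= B.
  have /cvg_series_bounded[M [_ /(_ (`|M| + 1))]] : cvgn (series (fun k => a k * q ^+ k)).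
    apply/cvg_ex; exists (F q); apply: cvgF.
    by rewrite ger0_norm 1?ltW// /q; lra.
  move=> MB.
  have {}MB k : `|a k * q ^+ k| <= `|M| + 1.
    by apply: MB => //; rewrite ltr_pwDr ?ler_norm.
  by exists (`|M| + 1) => //; rewrite ltr_wpDl.
have Fm h : 0 < `|h| <= q / 2 ->
    `|F h - a m * h ^+ m| <= 2 * B * (`|h| / q) ^+ m.+1.
  move=> /andP[h0 hq]; set x := `|h| / q.
  have x0 : 0 < x by rewrite divr_gt0.
  have x2 : x <= 2^-1 by rewrite ler_pdivrMr// mulrC.
  have cvgFm : (fun N => series (fun k => a k * h ^+ k) (m.+1 + N)%N - a m * h ^+ m)
      @ \oo --> F h - a m * h ^+ m.
    apply: cvgB; last exact: cvg_cst.
    rewrite (_ : (fun _ => _) = (fun N => series (fun k => a k * h ^+ k) (N + m.+1)%N)).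
      by rewrite cvg_shiftn; apply: cvgF; rewrite (le_lt_trans hq)// /q; lra.
    by apply/funext => N; rewrite addnC.
  move/cvg_norm in cvgFm.
  rewrite -(cvg_lim _ cvgFm)//; apply: limr_le; first by apply/cvg_ex; eexists; exact: cvgFm.
  apply: nearW => N; rewrite /series/= (big_cat_nat (n := m.+1))//= ?leq_addr//.
  rewrite big_nat_recr//= big_nat big1 ?add0r; last first.
    by move=> k /a0 ->; rewrite mul0r.
  rewrite addrAC subrr add0r.
  rewrite (le_trans (ler_norm_sum _ _ _))//.
  apply: (@le_trans _ _ (\sum_(m.+1 <= k < m.+1 + N) B * x ^+ k)).
    apply: ler_sum => k _.
    rewrite (_ : a k * h ^+ k = (a k * q ^+ k) * (h / q) ^+ k); last first.
      rewrite (expr_div_n h) -mulrA.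
      by congr (_ * _); rewrite [RHS]mulrC divfK// expf_neq0// gt_eqF.
    rewrite normrM normrX normf_div (gtr0_norm q0) ler_wpM2r//.
    by rewrite exprn_ge0// ltW.
  rewrite -mulr_sumr geometric_partial_tail.
  have x1 : `|x| < 1 by rewrite gtr0_norm// (le_lt_trans x2)//; lra.
  have := geometric_le_lim N (ltW (exprn_gt0 m.+1 x0)) x0 x1.
  move=> /(ler_wpM2l (ltW B0))/le_trans; apply.
  rewrite (_ : 2 * B * x ^+ m.+1 = B * (x ^+ m.+1 * 2)); last by ring.
  rewrite ler_wpM2l ?(ltW B0)// ler_wpM2l ?exprn_ge0 ?(ltW x0)//.
  rewrite invf_ple ?posrE; lra.
(* The second bound is the value of [|h|] at which [2 * B * (|h| / q) ^+ m.+1] reaches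
   [|a m| * |h| ^+ m]; below it the remainder cannot cancel the leading term. *)
pose d := Num.min (q / 2) (`|a m| * q ^+ m.+1 / (2 * B)).
have d0 : 0 < d.
  by rewrite lt_min !divr_gt0//= ?mulr_gt0// ?normr_gt0 ?exprn_gt0.
exists d => // h /andP[h0]; rewrite lt_min => /andP[hq hd].
apply/negP => /eqP Fh0; have := Fm h; rewrite h0 (ltW hq) => /(_ isT).
rewrite Fh0 sub0r normrN normrM normrX expr_div_n exprS.
rewrite (_ : 2 * B * (`|h| * `|h| ^+ m / q ^+ m.+1) =
  (2 * B * `|h| / q ^+ m.+1) * `|h| ^+ m); last by ring.
rewrite ler_pM2r ?exprn_gt0// ler_pdivlMr ?exprn_gt0//.
move: hd; rewrite ltr_pdivlMr ?mulr_gt0// mulrC => hd.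
by rewrite leNgt hd.
Qed.

(** Bolzano-Weierstrass: an infinite set would have a limit point, which stays in the closed
    segment. This point need not belong to [Z], hence isolation is asked at every point of the
    segment. *)
Lemma finite_isolated (Z : set R) (a b : R) :
  (forall x, a <= x <= b -> exists2 d, 0 < d & forall y, 0 < `|y - x| < d -> ~ Z y) ->
  finite_set (Z `&` [set x | a <= x <= b]).
Proof.
move=> isoZ; apply: contrapT => infZ.
have [] := infinite_bounded_limit_point_nonempty infZ.
  exists (`|a| + `|b|); split; first by rewrite num_real.
  move=> M abM x [_ /andP[ax xb]]; apply: le_trans (ltW abM); rewrite ler_norml.
  apply/andP; split.
    have := normr_ge0 b; have := ler_norm (- a); rewrite normrN; lra.
  have := normr_ge0 a; have := ler_norm b; lra.
move=> p lp.
have abp : `[a, b]%classic p.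
  have : closure (Z `&` [set x | a <= x <= b]) p by exact: subset_limit_point.
  rewrite (_ : [set x | _] = `[a, b]%classic); last first.
    by apply/seteqP; split => x; rewrite /= in_itv.
  move=> /(closureS (@subIsetr _ _ _)).
  by have /closure_id <- : closed `[a, b]%classic by exact: interval_closed.
have [d d0 dZ] : exists2 d, 0 < d & forall y, 0 < `|y - p| < d -> ~ Z y.
  by apply: isoZ; move: abp; rewrite /= in_itv.
have [y [yp [Zy _]]] := lp (ball p d) (nbhsx_ballx p d d0).
rewrite /ball/= distrC => pyd; apply: (dZ y) => //.
by rewrite normr_gt0 subr_eq0 yp.
Qed.

End isolated_zeros.

(** * Parity of the number of sign changes *)

Section parity.
Context {R : realType}.
Implicit Types (g : R -> R) (l u x y z : R).

(** The third clause of [inflection_point], stated for the second derivative itself. *)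
Definition sign_change g z :=
  ((\forall q \near z^'-, g q < 0) /\ (\forall q \near z^'+, 0 < g q)) \/
  ((\forall q \near z^'-, 0 < g q) /\ (\forall q \near z^'+, g q < 0)).

Lemma same_sign g l u : l <= u -> (forall x, l <= x <= u -> {for x, continuous g}) ->
  (forall x, l <= x <= u -> g x != 0) -> 0 < g l * g u.
Proof.
move=> lu cg g0; rewrite ltNge; apply/negP => gg.
have [c] : exists2 c, c \in `[l, u] & g c = 0.
  apply: IVT => //.
    apply: continuous_in_subspaceT => x /set_mem/=; rewrite in_itv/=; exact: cg.
  have [gl|gl] := leP (g l) 0; have [gu|gu] := leP (g u) 0.
  - have : g l * g u != 0 by rewrite mulf_neq0 ?g0 ?lexx// lu.
    by rewrite eq_le gg mulr_le0.
  - by rewrite ge_min le_max gl (ltW gu) orbT.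
  - by rewrite ge_min le_max gu (ltW gl) orbT.
  - by move: gg; rewrite leNgt mulr_gt0.
by rewrite in_itv/= => /g0 /eqP.
Qed.

(** Only [z] can be a zero, so by the intermediate value theorem [g] keeps the sign of [g l] to the
    left of [z] and that of [g u] to its right. *)
Lemma sign_changeE g l u z : l < z < u ->
  (forall x, l <= x <= u -> {for x, continuous g}) ->
  (forall x, l <= x <= u -> x != z -> g x != 0) ->
  sign_change g z <-> g l * g u < 0.
Proof.
move=> /andP[lz zu] cg g0.
have gleft : \forall q \near z^'-, 0 < g l * g q.
  near=> q; have lq : l < q by near: q; exact: nbhs_left_gt.
  have qz : q < z by near: q; exact: nbhs_left_lt.
  apply: same_sign; first exact: ltW.
    by move=> x /andP[lx xq]; apply: cg; rewrite lx (le_trans xq)// ltW// (lt_trans qz).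
  move=> x /andP[lx xq]; apply: g0; first by rewrite lx (le_trans xq)// ltW// (lt_trans qz).
  by rewrite lt_eqF// (le_lt_trans xq).
have gright : \forall q \near z^'+, 0 < g q * g u.
  near=> q; have lq : q < u by near: q; exact: nbhs_right_lt.
  have qz : z < q by near: q; exact: nbhs_right_gt.
  apply: same_sign; first exact: ltW.
    by move=> x /andP[lx xq]; apply: cg; rewrite xq (le_trans _ lx)// ltW// (lt_trans lz).
  move=> x /andP[lx xq]; apply: g0; first by rewrite xq (le_trans _ lx)// ltW// (lt_trans lz).
  by rewrite gt_eqF// (lt_le_trans qz).
split=> [[[gl gr]|[gl gr]]|].
- have [q [gq gq']] : exists q, g q < 0 /\ 0 < g l * g q.
    by apply: (@filter_ex _ z^'-); apply: filterI.
  have [p [gp gp']] : exists p, 0 < g p /\ 0 < g p * g u.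
    by apply: (@filter_ex _ z^'+); apply: filterI.
  move: gq'; rewrite nmulr_lgt0// => gl0.
  by move: gp'; rewrite pmulr_rgt0// => gu0; rewrite nmulr_rlt0.
- have [q [gq gq']] : exists q, 0 < g q /\ 0 < g l * g q.
    by apply: (@filter_ex _ z^'-); apply: filterI.
  have [p [gp gp']] : exists p, g p < 0 /\ 0 < g p * g u.
    by apply: (@filter_ex _ z^'+); apply: filterI.
  move: gq'; rewrite pmulr_lgt0// => gl0.
  by move: gp'; rewrite nmulr_rgt0// => gu0; rewrite pmulr_rlt0.
- have [gl|gl|->] := ltgtP (g l) 0; last by rewrite mul0r ltxx.
  + rewrite nmulr_rlt0// => gu; left; split; near=> q.
      rewrite -(nmulr_rgt0 _ gl); near: q; exact: gleft.
    by rewrite -(pmulr_lgt0 _ gu); near: q; exact: gright.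
  + rewrite pmulr_rlt0// => gu; right; split; near=> q.
      rewrite -(pmulr_rgt0 _ gl); near: q; exact: gleft.
    by rewrite -(nmulr_lgt0 _ gu); near: q; exact: gright.
Unshelve. all: by end_near. Qed.

(** Induction on the increasing list of zeros. The segment is cut between the first zero and the
    next; the first piece contributes a sign change exactly when [g] has opposite signs at its ends,
    and parities add as signs multiply. *)
Lemma sign_changes_seq g (s : seq R) l u : l <= u -> g l != 0 -> g u != 0 ->
  (forall x, l <= x <= u -> {for x, continuous g}) ->
  path <%R l s -> (forall z, l <= z <= u -> (g z = 0 <-> z \in s)) ->
  (forall z, z \in s -> z < u) ->
  exists s' : seq R, [/\ uniq s',
    [set p | [/\ l <= p <= u, g p = 0 & sign_change g p]] = [set` s'] &
    odd (size s') = (g l * g u < 0)].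
Proof.
elim: s l => [|z s IH] l lu gl gu cg ps gs su.
  exists [::]; split => //.
    by apply/seteqP; split => p //= [lpu /(gs p lpu)].
  apply/esym/negbTE; rewrite -leNgt ltW//; apply: same_sign => // x lxu.
  by apply/eqP => /(gs x lxu).
have /= /andP[lz pzs] := ps.
have zu : z < u by apply: su; rewrite mem_head.
(* [h] is the next zero, or [u] if [z] is the last one; in both cases [g] does not vanish at the
   midpoint [v] of [z] and [h]. *)
pose h := head u s.
have zh : z < h by rewrite /h; case: (s) pzs => //= y s' /andP[].
have hu : h <= u.
  by rewrite /h; case: (s) su => //= y s' su; rewrite ltW// su// !inE eqxx orbT.
pose v := (z + h) / 2.
have zv : z < v by rewrite /v; lra.
have vh : v < h by rewrite /v; lra.
have vu : v < u by exact: lt_le_trans hu.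
have pvs : path <%R v s by move: pzs vh; rewrite /h; case: (s) => //= y s' /andP[_ ->] ->.
have vs : all (> v) s by rewrite (order_path_min _ pvs)//; exact: lt_trans.
have g0v x : l <= x <= v -> x != z -> g x != 0.
  move=> /andP[lx xv] xz; apply/eqP => /gs; rewrite lx (le_trans xv (ltW vu)) => /(_ isT).
  rewrite inE (negbTE xz)/= => /(allP vs); lra.
have gv : g v != 0 by apply: g0v; rewrite ?gt_eqF// lexx andbT ltW// (lt_trans lz).
have cgv x : v <= x <= u -> {for x, continuous g}.
  by move=> /andP[vx xu]; apply: cg; rewrite xu (le_trans _ vx)// ltW// (lt_trans lz).
have [||s' [us' Es' os']] := IH v (ltW vu) gv gu cgv pvs.
- move=> x /andP[vx xu]; rewrite gs; last by rewrite xu (le_trans _ vx)// ltW// (lt_trans lz).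
  by rewrite inE gt_eqF//= (lt_le_trans zv).
- by move=> x xs; apply: su; rewrite inE xs orbT.
have s'v x : x \in s' -> v <= x.
  by move=> xs'; have : [set` s'] x := xs'; rewrite -Es' => -[/andP[]].
have gz : g z = 0 by apply/gs; rewrite ?mem_head// !ltW.
have split_set p : [/\ l <= p <= u, g p = 0 & sign_change g p] <->
    (p = z /\ sign_change g z) \/ p \in s'.
  split=> [[/andP[lp pu] gp scp]|[[-> ?]|ps']].
  - have [pv|vp] := leP p v; last first.
      right; have : [set` s'] p by rewrite -Es'; split => //; rewrite pu ltW.
      by [].
    have [<-|/(g0v p)] := eqVneq p z; first by left.
    by rewrite lp pv gp eqxx => /(_ isT).
  - by split => //; rewrite !ltW.
  - have : [set` s'] p := ps'; rewrite -Es' => -[/andP[vp pu] ? ?]; split => //.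
    by rewrite pu (le_trans _ vp)// ltW// (lt_trans lz).
have scz : sign_change g z <-> g l * g v < 0.
  apply: sign_changeE => //; first by rewrite lz.
  by move=> x /andP[lx xv]; apply: cg; rewrite lx (le_trans xv)// ltW.
(* As [g v != 0], the signs at [l] and [u] differ exactly when they differ over just one of the two
   pieces. *)
have gE : (g l * g u < 0) = ((g l * g v < 0) (+) (g v * g u < 0)).
  move: gl gv gu; rewrite !neq_lt.
  by move=> /orP[gl|gl] /orP[gv|gv] /orP[gu|gu];
    rewrite ?(nmulr_rlt0 _ gl) ?(pmulr_rlt0 _ gl) ?(nmulr_rlt0 _ gv) ?(pmulr_rlt0 _ gv)
    ?gu ?gv ?(lt_gtF gu) ?(lt_gtF gv).
have [glv|glv] := boolP (g l * g v < 0).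
- exists (z :: s'); split.
  + by rewrite /= us' andbT; apply/negP => /s'v; lra.
  + apply/seteqP; split => p /=.
      by move/split_set => [[-> _]|ps']; rewrite inE ?eqxx// ps' orbT.
    rewrite inE => /orP[/eqP ->|ps']; apply/split_set; [left|by right].
    by split => //; apply/scz.
  + by rewrite gE/= os' glv.
- exists s'; split => //.
  + apply/seteqP; split => p /=.
      by move/split_set => [[_ /scz]|//]; rewrite (negbTE glv).
    by move=> ps'; apply/split_set; right.
  + by rewrite gE/= os' (negbTE glv).
Qed.

Lemma odd_sign_changes g l u : l <= u -> 0 < g l -> g u < 0 ->
  (forall x, l <= x <= u -> {for x, continuous g}) ->
  finite_set ([set z | g z = 0] `&` [set z | l <= z <= u]) ->
  odd_card [set p | [/\ l <= p <= u, g p = 0 & sign_change g p]].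
Proof.
move=> lu gl gu cg /finite_seqP[t Et].
pose s := sort <=%R (undup t).
have ms z : (z \in s) = (z \in t) by rewrite mem_sort mem_undup.
have Ps z : z \in s <-> g z = 0 /\ l <= z <= u.
  rewrite ms; have -> : (z \in t) = ([set` t] z) :> Prop by [].
  by rewrite -Et.
have lts z : z \in s -> l < z < u.
  move=> /Ps[gz /andP[lz zu]]; rewrite !lt_neqAle lz zu !andbT.
  apply/andP; split; apply/eqP => E; first by move: gl; rewrite E gz ltxx.
  by move: gu; rewrite -E gz ltxx.
have [|||||s' [us' -> os']] := @sign_changes_seq g s l u lu _ _ cg.
- by rewrite gt_eqF.
- by rewrite lt_eqF.
- rewrite path_min_sorted ?sort_lt_sorted ?undup_uniq//.
  by apply/allP => z /lts/andP[].
- by move=> z lzu; split => [gz|/Ps[]//]; apply/Ps.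
- by move=> z /lts/andP[].
exists (size s'); first by rewrite os' pmulr_rlt0.
rewrite (_ : [set` s'] = nth 0 s' @` `I_(size s')); last first.
  apply/seteqP; split => [x xs'|x [j js' <-]] /=; last exact: mem_nth.
  by exists (index x s'); rewrite ?nth_index//= index_mem.
by apply: inj_card_eq => j k /set_mem js' /set_mem ks' /eqP; rewrite nth_uniq// => /eqP.
Qed.

End parity.

(** * Lebesgue measure and Gaussian integrals on row vectors *)

Section homothety.
Context {R : realType}.
Implicit Types (c : R) (n : nat).

Definition homothety n c (v x : 'rV[R]_n) : 'rV[R]_n := c *: x + v.

Lemma measurable_homothety n c (v : 'rV[R]_n) :
  measurable_fun [set: 'rV[R]_n] (homothety c v).
Proof.
apply: measurable_fun_rVP => i.
rewrite (_ : _ \o _ = fun x => c * rV_coord i x + v 0 i).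
  apply: measurable_funD => //; apply: measurable_funM => //.
  exact: measurable_rV_coord.
by apply/funext => x; rewrite /rV_coord /homothety /= !mxE.
Qed.

(** By uniqueness of Lebesgue measure: the image measure, rescaled by [c], gives every half-open
    interval its length. *)
Lemma lebesgue_measure_affine c (v : R) (A : set (measurableTypeR R)) : 0 < c ->
  measurable A ->
  lebesgue_measure ((fun x : measurableTypeR R => c * x + v : measurableTypeR R) @^-1` A)
    = (c^-1%:E * lebesgue_measure A)%E.
Proof.
move=> c0 mA; pose T (x : measurableTypeR R) : measurableTypeR R := c * x + v.
have mT : measurable_fun setT T.
  by apply: measurable_funD => //; exact: measurable_funM.
pose nu : {measure set (measurableTypeR R) -> \bar R} :=
  mscale (NngNum (ltW c0)) (pushforward (@lebesgue_measure R) T).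
suff : lebesgue_measure A = nu mT A.
  move=> ->; rewrite /nu/= /mscale/= muleA -EFinM mulVf ?mul1e//.
  by rewrite gt_eqF.
apply: lebesgue_measure_unique => // _ [[a b]] _ <-.
rewrite /nu/= /mscale/= /pushforward.
rewrite (_ : _ @^-1` _ = `](a - v) / c, (b - v) / c]%classic); last first.
  apply/seteqP; split => x /=; rewrite !in_itv/= /T ltr_pdivrMr// ler_pdivlMr//;
  by rewrite ltrBlDr lerBrDr (mulrC x).
rewrite !lebesgue_measure_itv/= !lte_fin ltr_pM2r ?invr_gt0// ltrD2r.
case: ifP => _; last by rewrite mule0.
rewrite -!EFinD -EFinM; congr EFin; field; exact: lt0r_neq0.
Qed.

(** Induction on the dimension: a homothety acts separately on the first coordinate and on the
    others, and the rescaled image measure agrees with the product measure on rectangles. *)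
Lemma lebesgue_rV_homothety n c (v : 'rV[R]_n) (A : set 'rV[R]_n) : 0 < c ->
  measurable A ->
  lebesgue_rV n (homothety c v @^-1` A) = ((c^-1 ^+ n)%:E * lebesgue_rV n A)%E.
Proof.
move=> c0; elim: n v A => [|n IH] v A mA.
  rewrite expr0 mul1e (_ : homothety c v = id) ?preimage_id//.
  by apply/funext => x; apply/rowP; case.
rewrite /= /cons_measure /pushforward.
pose w : 'rV[R]_n := \row_j v 0 (lift ord0 j).
pose T1 (x : measurableTypeR R) : measurableTypeR R := c * x + v 0 ord0.
pose T (p : measurableTypeR R * 'rV[R]_n) := (T1 p.1, homothety c w p.2).
have mT1 : measurable_fun setT T1.
  by apply: measurable_funD => //; exact: measurable_funM.
have mT : measurable_fun setT T.
  apply/measurable_fun_pairP; split.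
    by apply: (measurableT_comp mT1); exact: measurable_fst.
  by apply: (measurableT_comp (measurable_homothety c w)); exact: measurable_snd.
pose nu : {measure set (measurableTypeR R * 'rV[R]_n) -> \bar R} :=
  mscale (NngNum (exprn_ge0 n.+1 (ltW c0)))
    (pushforward (@lebesgue_measure R \x lebesgue_rV n)%E T).
pose B := @cons_rV R n @^-1` A.
have mB : measurable B.
  by rewrite -[X in measurable X]setTI; exact: measurable_cons_rV.
have consT p : homothety c v (cons_rV p) = cons_rV (T p).
  apply/rowP => i; rewrite /homothety !mxE.
  by case: unliftP => [j ->|->]; rewrite ?mxE.
have -> : @cons_rV R n @^-1` (homothety c v @^-1` A) = T @^-1` B.
  by apply/seteqP; split => p /=; rewrite /B /preimage/= consT.
have -> : ((@lebesgue_measure R \x lebesgue_rV n) B)%E = nu mT B.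
  apply: product_measure_unique => // C D mC mD.
  rewrite /nu/= /mscale/= /pushforward.
  rewrite (_ : T @^-1` _ = (T1 @^-1` C) `*` (homothety c w @^-1` D)); last first.
    by apply/seteqP; split.
  rewrite product_measure1E; last 2 first.
  - by rewrite -[X in measurable X]setTI; exact: mT1.
  - by rewrite -[X in measurable X]setTI; exact: measurable_homothety.
  rewrite IH// [X in (_ * (X * _))%E](lebesgue_measure_affine _ c0 mC) muleACA.
  have cE : ((c ^+ n.+1)%:E * (c^-1%:E * (c^-1 ^+ n)%:E) = 1)%E.
    by rewrite -!EFinM -exprS exprVn divff// expf_neq0// gt_eqF.
  by rewrite [LHS]muleA cE mul1e.
rewrite /nu/= /mscale/= muleA -EFinM exprVn mulVf ?mul1e//.
by rewrite expf_neq0// gt_eqF.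
Qed.

End homothety.

Section dot_theory.
Context {R : realType} {n : nat}.
Implicit Types (x y z a : 'rV[R]_n) (c : R).

Lemma dotC x y : dot x y = dot y x.
Proof. by apply: eq_bigr => k _; rewrite mulrC. Qed.

Lemma dotDr a x y : dot a (x + y) = dot a x + dot a y.
Proof. by rewrite /dot -big_split/=; apply: eq_bigr => k _; rewrite mxE mulrDr. Qed.

Lemma dotZr c a x : dot a (c *: x) = c * dot a x.
Proof. by rewrite /dot mulr_sumr; apply: eq_bigr => k _; rewrite mxE mulrCA. Qed.

Lemma dotDl x y a : dot (x + y) a = dot x a + dot y a.
Proof. by rewrite dotC dotDr !(dotC a). Qed.

Lemma dotZl c x a : dot (c *: x) a = c * dot x a.
Proof. by rewrite dotC dotZr dotC. Qed.

Lemma dotxx_ge0 x : 0 <= dot x x.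
Proof. by apply: sumr_ge0 => k _; rewrite -expr2 sqr_ge0. Qed.

Lemma dotxx_eq0 x : (dot x x == 0) = (x == 0).
Proof.
apply/idP/eqP => [|->]; last first.
  by rewrite /dot big1// => k _; rewrite mxE mul0r.
rewrite psumr_eq0 => [/allP x0|k _]; last by rewrite -expr2 sqr_ge0.
apply/rowP => k; rewrite mxE.
have : x 0 k * x 0 k == 0 by have /implyP-> := x0 k (mem_index_enum k).
by rewrite mulf_eq0 orbb => /eqP.
Qed.

Lemma sqr_enorm x : enorm x ^+ 2 = dot x x.
Proof. by rewrite sqr_sqrtr// dotxx_ge0. Qed.

Lemma enorm_ge0 x : 0 <= enorm x. Proof. exact: sqrtr_ge0. Qed.

(** Cauchy-Schwarz for a unit vector, from the nonnegative square of [x - dot a x *: a]. *)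
Lemma dot_sqr_le a x : dot a a = 1 -> dot a x ^+ 2 <= dot x x.
Proof.
move=> a1; have := dotxx_ge0 (x + (- dot a x) *: a).
rewrite !dotDl !dotDr !dotZl !dotZr a1 (dotC x a); lra.
Qed.

Lemma normr_dot_le a x : `|dot a x| <= (dot a a + dot x x) / 2.
Proof.
have := dotxx_ge0 (x + a); have := dotxx_ge0 (x + (- 1) *: a).
rewrite !dotDl !dotDr !dotZl !dotZr (dotC x a) ler_norml; lra.
Qed.

Lemma measurable_dot a : measurable_fun [set: 'rV[R]_n] (dot a).
Proof.
apply: measurable_sum => k; apply: measurable_funM => //.
exact: (measurable_rV_coord k).
Qed.

Lemma measurable_dotxx : measurable_fun [set: 'rV[R]_n] (fun x => dot x x).
Proof.
by apply: measurable_sum => k; apply: measurable_funM => //;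
  exact: (measurable_rV_coord k).
Qed.

(** For [k = 0] and [t = (2 * P)^-1] this is the Gaussian density of variance [P] without its
    normalization; differentiating in [t] raises [k] by one and changes the sign. *)
Definition radial_gauss k (t : R) x : R := dot x x ^+ k * expR (- (t * dot x x)).

Lemma radial_gauss_ge0 k t x : 0 <= radial_gauss k t x.
Proof. by rewrite mulr_ge0 ?expR_ge0// exprn_ge0// dotxx_ge0. Qed.

Lemma measurable_radial_gauss k t : measurable_fun [set: 'rV[R]_n] (radial_gauss k t).
Proof.
apply: measurable_funM; first by apply: measurable_funX; exact: measurable_dotxx.
apply: measurableT_comp => //; apply: measurableT_comp => //.
by apply: measurable_funM => //; exact: measurable_dotxx.
Qed.

End dot_theory.

Section gaussian_integrals.
Context {R : realType}.
Implicit Types (n k : nat) (t : R).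

(** Read off from the total mass 1 of the normal density of variance [(2 * t)^-1]. *)
Lemma integral_gauss1 t : 0 < t ->
  (\int[@lebesgue_measure R]_x (expR (- (t * x ^+ 2)))%:E = (Num.sqrt (pi / t))%:E)%E.
Proof.
move=> t0; pose s := Num.sqrt (t^-1 / 2).
have s0 : s != 0 by rewrite gt_eqF// sqrtr_gt0 divr_gt0// invr_gt0.
have s2 : s ^+ 2 = t^-1 / 2 by rewrite sqr_sqrtr// divr_ge0// invr_ge0 ltW.
have peak0 := normal_peak_gt0 s0.
have peakE : normal_peak s = (Num.sqrt (pi / t))^-1.
  rewrite /normal_peak; congr (Num.sqrt _)^-1; rewrite s2 -mulr_natr; field; exact: lt0r_neq0.
transitivity (\int[@lebesgue_measure R]_x (normal_fun 0 s x)%:E)%E.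
  apply: eq_integral => x _; rewrite /normal_fun subr0 s2 -mulr_natr; congr ((expR _)%:E).
  by field; exact: lt0r_neq0.
have := integral_normal_pdf 0 s; rewrite normal_pdfE//.
under eq_integral do rewrite EFinM.
rewrite ge0_integralZl_EFin//=; last 3 first.
- by move=> x _; rewrite lee_fin normal_fun_ge0.
- by apply/measurable_EFinP; exact: measurable_normal_fun.
- exact: ltW.
move=> E; rewrite -[RHS]mule1 -E muleA -EFinM peakE mulfV ?mul1e//.
by move: peak0; rewrite peakE invr_gt0 => /lt0r_neq0.
Qed.

Lemma dot_cons n (p : measurableTypeR R * 'rV[R]_n) :
  dot (cons_rV p) (cons_rV p) = p.1 ^+ 2 + dot p.2 p.2.
Proof.
rewrite /dot big_ord_recl !mxE unlift_none expr2; congr (_ + _).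
by apply: eq_bigr => k _; rewrite !mxE liftK.
Qed.

Lemma integral_radial_gauss0 n t : 0 < t ->
  (\int[lebesgue_rV n]_x (radial_gauss 0 t x)%:E = (Num.sqrt (pi / t) ^+ n)%:E)%E.
Proof.
move=> t0; elim: n => [|n IH].
  rewrite integral_dirac//; last by apply/measurable_EFinP; exact: measurable_radial_gauss.
  by rewrite diracT mul1e /radial_gauss /dot big_ord0 mulr0 oppr0 expR0 mulr1.
rewrite /= /cons_measure ge0_integral_pushforward//; last 3 first.
- exact: measurable_cons_rV.
- by apply/measurable_EFinP; exact: measurable_radial_gauss.
- by move=> x _; rewrite lee_fin radial_gauss_ge0.
rewrite preimage_setT fubini_tonelli1//; last 2 first.
- apply: measurableT_comp; last exact: measurable_cons_rV.
  by apply/measurable_EFinP; exact: measurable_radial_gauss.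
- by move=> x; rewrite lee_fin radial_gauss_ge0.
have step (x : measurableTypeR R) : (\int[lebesgue_rV n]_y
      (radial_gauss 0 t (cons_rV (x, y)))%:E =
    (Num.sqrt (pi / t) ^+ n)%:E * (expR (- (t * x ^+ 2)))%:E)%E.
  rewrite -IH muleC -ge0_integralZl_EFin ?expR_ge0//.
  - apply: eq_integral => y _; rewrite -EFinM /radial_gauss !expr0 !mul1r dot_cons/=.
    by rewrite mulrDr opprD expRD.
  - by move=> y _; rewrite lee_fin radial_gauss_ge0.
  - by apply/measurable_EFinP; exact: measurable_radial_gauss.
under eq_integral do rewrite /fubini_F/= step.
rewrite ge0_integralZl_EFin//.
- by rewrite integral_gauss1// -EFinM exprSr.
- apply/measurable_EFinP; apply: measurableT_comp => //; apply: measurableT_comp => //.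
  by apply: measurable_funM => //; exact: measurable_funX.
Qed.

(** Half of the exponent absorbs one factor, as [u * expR (- (t / 2 * u)) <= 2 / t]. The induction
    on [k] therefore lets [t] vary. *)
Lemma integrable_radial_gauss n k t (A : set 'rV[R]_n) : measurable A -> 0 < t ->
  (lebesgue_rV n).-integrable A (EFin \o radial_gauss k t).
Proof.
move=> mA t0; apply: (@integrableS _ _ _ _ setT) => //.
elim: k t t0 => [|k IH] t t0.
  apply/integrableP; split; first by apply/measurable_EFinP; exact: measurable_radial_gauss.
  under eq_integral do rewrite /= ger0_norm ?radial_gauss_ge0//.
  by rewrite integral_radial_gauss0// ltry.
apply: (@le_integrable _ _ _ _ _ measurableT _
  (fun x => (2 / t)%:E * (EFin \o radial_gauss k (t / 2)) x)%E) => //.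
- by apply/measurable_EFinP; exact: measurable_radial_gauss.
- move=> x _ /=; rewrite lee_fin !ger0_norm ?radial_gauss_ge0//; last first.
    by rewrite mulr_ge0 ?radial_gauss_ge0// divr_ge0// ltW.
  rewrite (_ : radial_gauss k.+1 t x =
      dot x x * expR (- (t / 2 * dot x x)) * radial_gauss k (t / 2) x); last first.
    rewrite /radial_gauss exprS (_ : - (t * _) = - (t / 2 * dot x x) - (t / 2 * dot x x)).
      by rewrite expRD; ring.
    by lra.
  rewrite ler_wpM2r ?radial_gauss_ge0// expRN ler_pdivrMr ?expR_gt0//.
  rewrite -ler_pdivrMl ?divr_gt0// invf_div.
  by rewrite (le_trans _ (expR_ge1Dx _))// lerDr.
- by apply: integrableZl => //; apply: IH; rewrite divr_gt0.
Qed.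

End gaussian_integrals.

(** * Gaussian moments over a set as functions of the parameter *)

Section radial_moments.
Context {R : realType} {n : nat}.
Implicit Types (A B : set 'rV[R]_n) (k : nat) (t : R).

Definition radial_moment A k t : R := \int[lebesgue_rV n]_(x in A) radial_gauss k t x.

Lemma radial_moment_ge0 A k t : 0 <= radial_moment A k t.
Proof. by apply: Rintegral_ge0 => x _; exact: radial_gauss_ge0. Qed.

Lemma EFin_radial_moment A k t : measurable A -> 0 < t ->
  (radial_moment A k t)%:E = (\int[lebesgue_rV n]_(x in A) (radial_gauss k t x)%:E)%E.
Proof.
move=> mA t0; rewrite /radial_moment /Rintegral fineK//.
by apply: integrable_fin_num => //; exact: integrable_radial_gauss.
Qed.

Lemma radial_momentU A B k t : measurable A -> measurable B -> A `&` B = set0 -> 0 < t ->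
  radial_moment (A `|` B) k t = radial_moment A k t + radial_moment B k t.
Proof.
move=> mA mB AB t0; apply: Rintegral_setU => //.
  by apply: integrable_radial_gauss => //; exact: measurableU.
by apply/disj_set2P.
Qed.

Lemma is_derive_radial_gauss k (x : 'rV[R]_n) t :
  is_derive t 1 (fun u => radial_gauss k u x) (- radial_gauss k.+1 t x).
Proof.
have d := is_derive1M (is_derive_id t 1) (is_derive_cst (dot x x) t (1 : R)).
have := is_derive1Z (dot x x ^+ k) (is_derive1_expR (is_deriveN d)).
move/is_derive_eq; apply.
by rewrite /radial_gauss exprSr mulr0 addr0 mul1r/=; ring.
Qed.

(** Differentiation under the integral sign: for parameters between [t / 2] and [t * 2] the
    derivative of the integrand is dominated by the integrand of order [k.+1] at [t / 2]. *)
Lemma is_derive_radial_moment A k t : measurable A -> 0 < t ->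
  is_derive t 1 (radial_moment A k) (- radial_moment A k.+1 t).
Proof.
move=> mA t0.
have It : `]t / 2, t * 2[%classic t by rewrite /= in_itv/=; lra.
have partialE (u : R) (x : 'rV[R]_n) : partial1of2 (radial_gauss k) u x = - radial_gauss k.+1 u x.
  by have [_ <-] := is_derive_radial_gauss k x u; rewrite /partial1of2 derive1E.
have intf u : `]t / 2, t * 2[%classic u ->
    (lebesgue_rV n).-integrable A (EFin \o radial_gauss k u).
  by rewrite /= in_itv/= => /andP[tu _]; apply: integrable_radial_gauss => //; lra.
have df (u : R) (x : 'rV[R]_n) : `]t / 2, t * 2[%classic u -> A x ->
    derivable ((radial_gauss k)^~ x) u 1.
  by move=> _ _; have [] := is_derive_radial_gauss k x u.
have intG : (lebesgue_rV n).-integrable A (EFin \o radial_gauss k.+1 (t / 2)).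
  by apply: integrable_radial_gauss => //; lra.
have Gub (u : R) (x : 'rV[R]_n) : `]t / 2, t * 2[%classic u -> A x ->
    `|partial1of2 (radial_gauss k) u x| <= radial_gauss k.+1 (t / 2) x.
  rewrite /= in_itv/= => /andP[tu _] _.
  rewrite partialE normrN ger0_norm ?radial_gauss_ge0// /radial_gauss.
  by rewrite ler_wpM2l ?exprn_ge0 ?dotxx_ge0// ler_expR lerN2 ler_wpM2r ?dotxx_ge0// ltW.
apply: DeriveDef.
  exact: (derivable_under_integral mA It intf df (@radial_gauss_ge0 _ _ _ _) intG Gub).
rewrite -derive1E.
rewrite (differentiation_under_integral mA It intf df (@radial_gauss_ge0 _ _ _ _) intG Gub).
rewrite -mulN1r -RintegralZl//; last exact: integrable_radial_gauss.
by apply: eq_Rintegral => x _; rewrite partialE mulN1r.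
Qed.

(** The exponential series of [expR (- (h * dot x x))] is integrated term by term. Its partial sums
    are bounded by [expR (|h| * dot x x)], which leaves an integrable function as long as
    [|h| < t]. *)
Lemma radial_moment_power_series A k t h : measurable A -> `|h| < t ->
  series (fun j => (-1) ^+ j / j`!%:R * radial_moment A (k + j) t * h ^+ j) @ \oo
    --> radial_moment A k (t + h).
Proof.
move=> mA ht; have t0 : 0 < t by exact: le_lt_trans ht.
have th0 : 0 < t - `|h| by rewrite subr_gt0.
have th0' : 0 < t + h by move: ht; rewrite ltr_norml; lra.
pose f_ N (x : 'rV[R]_n) := radial_gauss k t x * series (exp_coeff (- (h * dot x x))) N.
have f_E N : (fun x => (f_ N x)%:E) =
    (fun x => \sum_(j < N) (((-1) ^+ j / j`!%:R * h ^+ j)%R%:E * (radial_gauss (k + j) t x)%:E))%E.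
  apply/funext => x; rewrite /f_ /series/= big_mkord mulr_sumr -sumEFin.
  apply: eq_bigr => j _; rewrite exp_coeffE -EFinM /radial_gauss exprD; congr EFin.
  by rewrite (exprNn (h * dot x x)) exprMn; ring.
have mf_ N : measurable_fun A (fun x => (f_ N x)%:E).
  rewrite f_E; apply: emeasurable_sum => j.
  apply/measurable_EFinP; apply: measurable_funM => //.
  by apply: measurable_funTS; exact: measurable_radial_gauss.
have intE N : (\int[lebesgue_rV n]_(x in A) (f_ N x)%:E =
    (series (fun j => (-1) ^+ j / j`!%:R * radial_moment A (k + j) t * h ^+ j) N)%:E)%E.
  rewrite f_E integral_sum//; last first.
    by move=> j; apply: integrableZl => //; exact: integrable_radial_gauss.
  rewrite /series/= big_mkord -sumEFin; apply: eq_bigr => j _.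
  rewrite integralZl//; last exact: integrable_radial_gauss.
  by rewrite -EFin_radial_moment// -EFinM; congr EFin; ring.
have cvgf (x : 'rV[R]_n) : A x -> (f_ N x)%:E @[N --> \oo] --> (radial_gauss k (t + h) x)%:E.
  move=> _; apply: cvg_EFin; first exact: nearW.
  rewrite (_ : radial_gauss k (t + h) x = radial_gauss k t x * expR (- (h * dot x x))).
    by apply: cvgM; [exact: cvg_cst|exact: is_cvg_series_exp_coeff].
  by rewrite /radial_gauss -mulrA -expRD mulrDl opprD.
have f_ub N (x : 'rV[R]_n) : A x -> (`|(f_ N x)%:E| <= (radial_gauss k (t - `|h|) x)%:E)%E.
  move=> _; rewrite lee_fin /f_ normrM ger0_norm ?radial_gauss_ge0//.
  rewrite (_ : radial_gauss k (t - `|h|) x = radial_gauss k t x * expR (`|h| * dot x x)).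
    rewrite ler_wpM2l ?radial_gauss_ge0//.
    have -> : `|h| * dot x x = `|- (h * dot x x)|.
      by rewrite normrN normrM (ger0_norm (dotxx_ge0 x)).
    rewrite (le_trans (ler_norm_sum _ _ _))//.
    rewrite -[X in X <= _]/([normed series (exp_coeff (- (h * dot x x)))] N).
    rewrite normed_series_exp_coeff.
    apply: nondecreasing_cvgn_le; last exact: is_cvg_series_exp_coeff.
    by apply: nondecreasing_series => j _ _; exact: exp_coeff_ge0.
  by rewrite /radial_gauss -mulrA -expRD; congr (_ * expR _); ring.
have := @dominated_cvg _ _ _ (lebesgue_rV n) A mA (fun N x => (f_ N x)%:E)
  (fun x => (radial_gauss k (t + h) x)%:E)
  (fun x => (radial_gauss k (t - `|h|) x)%:E) mf_ cvgf (fun x _ => isT)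
  (integrable_radial_gauss k mA th0) f_ub.
under eq_fun do rewrite intE.
rewrite -EFin_radial_moment//.
by move/fine_cvgP => -[_].
Qed.

End radial_moments.

(** * Analytic functions on the positive axis and the identity principle *)

Section local_power_series.
Context {R : realType}.
Implicit Types (F G : R -> R) (t c : R).

(** The expansion about [t] has to be valid up to distance [t], that is between 0 and [2 * t]. This
    explicit radius is what lets vanishing spread along the positive axis. *)
Definition has_power_series F t := exists a : R^nat, forall h, `|h| < t ->
  series (fun k => a k * h ^+ k) @ \oo --> F (t + h).

Lemma has_power_seriesD F G t : has_power_series F t -> has_power_series G t ->
  has_power_series (fun u => F u + G u) t.
Proof.
move=> [a aF] [b bG]; exists (fun k => a k + b k) => h ht.
rewrite (_ : series _ = series (fun k => a k * h ^+ k) + series (fun k => b k * h ^+ k)).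
  by apply: cvgD; [exact: aF|exact: bG].
by rewrite -seriesD; congr series; apply/funext => k; rewrite mulrDl.
Qed.

Lemma has_power_seriesZ c F t : has_power_series F t ->
  has_power_series (fun u => c * F u) t.
Proof.
move=> [a aF]; exists (fun k => c * a k) => h ht.
rewrite (_ : series _ = c *: series (fun k => a k * h ^+ k)).
  by apply: cvgZl_tmp; exact: aF.
by rewrite -seriesZ; congr series; apply/funext => k; rewrite -mulrA.
Qed.

Lemma has_power_series_mulX F t : has_power_series F t ->
  has_power_series (fun u => u * F u) t.
Proof.
(* The factor is [u = t + h]: the first summand comes from [t], the shifted one from [h]. *)
move=> [a aF]; exists (fun k => t * a k + (if k is k'.+1 then a k' else 0)) => h ht.
rewrite mulrDl -(cvg_shiftS (series _)) /=.
pose s := series (fun k => a k * h ^+ k).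
rewrite (_ : (fun N => _) = (fun N => t * s N.+1 + h * s N)).
  apply: cvgD; apply: cvgM; try exact: cvg_cst; last exact: aF.
  by rewrite (cvg_shiftS s); exact: aF.
apply/funext => N; rewrite /s /series/= !mulr_sumr [in RHS]big_nat_recl//.
rewrite [LHS]big_nat_recl//= addr0 -!addrA mulrA; congr (_ + _).
by rewrite -big_split/=; apply: eq_bigr => k _; rewrite exprS; ring.
Qed.

(** Identity principle: if all coefficients at [t] vanished, [F] would vanish up to [2 * t] and
    then, by successive expansions, at every positive point, contrary to [F c != 0]. *)
Lemma has_power_series_isolated_zero F t c : 0 < t -> 0 < c -> F c != 0 ->
  (forall u, 0 < u -> has_power_series F u) ->
  exists2 d, 0 < d & forall u, 0 < `|u - t| < d -> F u != 0.
Proof.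
move=> t0 c0 Fc psF.
have dich u : 0 < u -> (forall v, 0 < v < 2 * u -> F v = 0) \/
    exists2 d, 0 < d & forall v, 0 < `|v - u| < d -> F v != 0.
  move=> u0; have [a aF] := psF _ u0.
  have [a0|[d d0 dF]] := power_series_isolated_zero u0 aF.
    left=> v /andP[v0 v2]; rewrite -(subrK u v) addrC.
    have /aF : `|v - u| < u by rewrite ltr_norml; lra.
    rewrite (_ : series _ = fun=> 0); first by move/cvg_lim => <-//; rewrite lim_cst.
    by apply/funext => N; rewrite /series/= big1// => k _; rewrite a0 mul0r.
  by right; exists d => // v /dF; rewrite addrC subrK.
have [F0|//] := dich t t0; exfalso; move/eqP: Fc; apply.
(* If [F] vanishes below [b], its zeros accumulate at [3 / 4 * b], so the expansion there is zero
   and [F] vanishes below [3 / 2 * b]. The gain [b / 2] is at least [t], since [2 * t <= b]. *)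
have F0m m v : 0 < v < 2 * t + t * m%:R -> F v = 0.
  elim: m v => [|m IH] v; first by rewrite mulr0 addr0; exact: F0.
  set b := 2 * t + t * m%:R in IH.
  have b2t : 2 * t <= b by rewrite /b lerDl mulr_ge0// ltW.
  have [F0b|[d d0 dF]] : (forall v, 0 < v < 2 * (3 / 4 * b) -> F v = 0) \/
      exists2 d, 0 < d & forall v, 0 < `|v - 3 / 4 * b| < d -> F v != 0.
  - by apply: dich; lra.
  - move=> /andP[v0 vb]; apply: F0b; rewrite v0 (lt_le_trans vb)//.
    have : t * m.+1%:R = t * m%:R + t by rewrite -natr1 mulrDr mulr1.
    by move: b2t; rewrite /b; lra.
  - pose e := Num.min (d / 2) (b / 8).
    have e0 : 0 < e by rewrite lt_min; lra.
    have ed : e <= d / 2 by rewrite ge_min lexx.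
    have eb : e <= b / 8 by rewrite ge_min lexx orbT.
    have : F (3 / 4 * b + e) != 0.
      by apply: dF; rewrite addrAC subrr add0r gtr0_norm//; lra.
    by rewrite IH ?eqxx//; lra.
apply: (F0m (Num.truncn (c / t)).+1); rewrite c0/=.
have : c / t < (Num.truncn (c / t)).+1%:R by apply: truncnS_gt.
by rewrite ltr_pdivrMr// mulrC; lra.
Qed.

End local_power_series.

(** * Gaussian probability of a set and its derivatives in the noise power *)

Section gauss_prob.
Context {R : realType} {n : nat}.
Implicit Types (A B : set 'rV[R]_n) (x : 'rV[R]_n) (k : nat) (P a : R).
Local Notation nu := (n%:R / 2 : R).

Definition gauss_prob A P : R := \int[lebesgue_rV n]_(x in A) gauss_density P x.

(** Derivatives in [P] of these functions are linear combinations of functions of the same form, so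
    one differentiation rule serves for all orders. *)
Definition gauss_term A a k P : R := P `^ a * radial_moment A k ((2 * P)^-1).

Definition gauss_prob1 A P : R := (2 * pi) `^ (- nu) *
  (- nu * gauss_term A (- nu - 1) 0 P + 2^-1 * gauss_term A (- nu - 2) 1 P).

Definition gauss_kernel P (x : 'rV[R]_n) : R :=
  dot x x ^+ 2 - 2 * (n%:R + 2) * P * dot x x + n%:R * (n%:R + 2) * P ^+ 2.

(** The second derivative for [0 < P], with the power of [P] factored out so that the bracket is the
    integral of [gauss_kernel] against the Gaussian. *)
Definition gauss_prob2 A P : R := (2 * pi) `^ (- nu) / 4 * P `^ (- nu - 4) *
  (radial_moment A 2 (2 * P)^-1 - 2 * (n%:R + 2) * P * radial_moment A 1 (2 * P)^-1
   + n%:R * (n%:R + 2) * P ^+ 2 * radial_moment A 0 (2 * P)^-1).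

Lemma gauss_densityE P x : 0 < P ->
  gauss_density P x = ((2 * pi) `^ (- nu) * P `^ (- nu)) * radial_gauss 0 (2 * P)^-1 x.
Proof.
move=> P0; rewrite /gauss_density /radial_gauss expr0 mul1r sqr_enorm mulrC.
rewrite -powRM ?(ltW P0)// ?mulr_ge0 ?pi_ge0// [RHS]mulrC; congr (expR (- _) * _).
by rewrite mulrC.
Qed.

Lemma gauss_probE A P : measurable A -> 0 < P ->
  gauss_prob A P = (2 * pi) `^ (- nu) * gauss_term A (- nu) 0 P.
Proof.
move=> mA P0; have P20 : 0 < (2 * P)^-1 by rewrite invr_gt0 mulr_gt0.
rewrite /gauss_term mulrA -RintegralZl//; last exact: integrable_radial_gauss.
by apply: eq_Rintegral => x _; rewrite gauss_densityE.
Qed.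

Lemma is_derive_gauss_term A a k P : measurable A -> 0 < P ->
  is_derive P 1 (gauss_term A a k)
    (a * gauss_term A (a - 1) k P + 2^-1 * gauss_term A (a - 2) k.+1 P).
Proof.
move=> mA P0; have P20 : 0 < (2 * P)^-1 by rewrite invr_gt0 mulr_gt0.
have P2 : 2 * P != 0 by rewrite mulf_neq0// gt_eqF.
have d := is_derive1V P2 (is_derive1Z 2 (is_derive_id P 1)).
have := @is_derive1_comp _ (radial_moment A k) (fun u => (2 * u)^-1) P _ _
  (is_derive_radial_moment k mA P20) d.
move/(is_derive1M (is_derive1_powR a P0))/is_derive_eq; apply => /=.
rewrite /gauss_term [P `^ (a - 2)]powRD; last by rewrite (gt_eqF P0) implybT.
rewrite powRN powR_mulrn ?(ltW P0)// mulrA; congr (_ + _); first by rewrite mulrA.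
by field; exact: lt0r_neq0.
Qed.

(** The closed formulas hold for positive [P] only; agreement near a positive point is enough to
    transfer derivatives to the total functions. *)
Lemma is_derive_near (f g : R -> R) (z df : R) : {near z, f =1 g} ->
  is_derive z 1 f df -> is_derive z 1 g df.
Proof.
move=> fg [Df <-]; apply: DeriveDef; last by apply/esym/near_eq_derive; rewrite ?oner_eq0.
by apply: near_eq_derivable Df; rewrite ?oner_eq0.
Qed.

Lemma is_derive_gauss_prob A P : measurable A -> 0 < P ->
  is_derive P 1 (gauss_prob A) (gauss_prob1 A P).
Proof.
move=> mA P0; have := is_derive1Z ((2 * pi) `^ (- nu)) (is_derive_gauss_term (- nu) 0 mA P0).
apply: is_derive_near; near=> Q; apply/esym/gauss_probE => //.
by near: Q; exact: lt_nbhsr.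
Unshelve. all: by end_near. Qed.

(** Brings all terms to one real exponent; the other powers of [P] are then natural, and what
    remains is an algebraic identity. *)
Lemma gauss_term_shift A a b k (j : nat) P : 0 < P -> b = a + j%:R ->
  gauss_term A b k P = P `^ a * P ^+ j * radial_moment A k (2 * P)^-1.
Proof.
move=> P0 ->; rewrite /gauss_term powRD; last by rewrite (gt_eqF P0) implybT.
by rewrite powR_mulrn ?(ltW P0).
Qed.

Lemma is_derive_gauss_prob1 A P : measurable A -> 0 < P ->
  is_derive P 1 (gauss_prob1 A) (gauss_prob2 A P).
Proof.
move=> mA P0.
have d0 := is_derive_gauss_term (- nu - 1) 0 mA P0.
have d1 := is_derive_gauss_term (- nu - 2) 1 mA P0.
have := is_derive1Z ((2 * pi) `^ (- nu))
  (is_derive1D (is_derive1Z (- nu) d0) (is_derive1Z 2^-1 d1)).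
move/is_derive_eq; apply; rewrite /gauss_prob2.
rewrite !(@gauss_term_shift _ (- nu - 4) (- nu - 1 - 1) _ 2)//; last by ring.
rewrite !(@gauss_term_shift _ (- nu - 4) (- nu - 1 - 2) _ 1)//; last by ring.
rewrite !(@gauss_term_shift _ (- nu - 4) (- nu - 2 - 1) _ 1)//; last by ring.
rewrite !(@gauss_term_shift _ (- nu - 4) (- nu - 2 - 2) _ 0)//; last by ring.
by rewrite expr0 expr1; field.
Qed.

Lemma gauss_prob_setT P : 0 < P -> gauss_prob setT P = 1.
Proof.
move=> P0; have P20 : 0 < (2 * P)^-1 by rewrite invr_gt0 mulr_gt0.
have piP : 0 <= 2 * pi * P by rewrite !mulr_ge0// ?pi_ge0// ltW.
rewrite gauss_probE// /gauss_term mulrA -powRM ?(ltW P0)// ?mulr_ge0 ?pi_ge0//.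
apply: EFin_inj; rewrite EFinM EFin_radial_moment//.
rewrite integral_radial_gauss0// -EFinM invrK (_ : pi * (2 * P) = 2 * pi * P); last by ring.
rewrite -(powR12_sqrt piP) -powR_mulrn ?powR_ge0// -powRrM.
rewrite (_ : 2^-1 * n%:R = nu); last by rewrite mulrC.
rewrite powRN mulVf// powR_eq0 negb_and; apply/orP; left.
by rewrite gt_eqF// !mulr_gt0// ?pi_gt0.
Qed.

(** The probability of the whole space is constantly 1, so both derivatives vanish without any
    computation of moments. *)
Lemma gauss_prob2_setT P : 0 < P -> gauss_prob2 setT P = 0.
Proof.
have g1 Q : 0 < Q -> gauss_prob1 setT Q = 0.
  move=> Q0; have [_ <-] := is_derive_gauss_prob measurableT Q0.
  have [_ <-] // : is_derive Q 1 (gauss_prob setT) 0.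
  have d1 : is_derive Q 1 (fun=> 1 : R) (0 : R) by exact: is_derive_cst.
  apply: is_derive_near d1; near=> T.
  by rewrite gauss_prob_setT//; near: T; exact: lt_nbhsr.
move=> P0; have [_ <-] := is_derive_gauss_prob1 measurableT P0.
have [_ <-] // : is_derive P 1 (gauss_prob1 setT) 0.
have d0 : is_derive P 1 (fun=> 0 : R) (0 : R) by exact: is_derive_cst.
apply: is_derive_near d0; near=> T.
by rewrite g1//; near: T; exact: lt_nbhsr.
Unshelve. all: by end_near. Qed.

Lemma gauss_prob2U A B P : measurable A -> measurable B -> A `&` B = set0 -> 0 < P ->
  gauss_prob2 (A `|` B) P = gauss_prob2 A P + gauss_prob2 B P.
Proof.
move=> mA mB AB P0; have P20 : 0 < (2 * P)^-1 by rewrite invr_gt0 mulr_gt0.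
by rewrite /gauss_prob2 !radial_momentU//; ring.
Qed.

Lemma gauss_prob2_kernel A P : measurable A -> 0 < P ->
  gauss_prob2 A P = (2 * pi) `^ (- nu) / 4 * P `^ (- nu - 4) *
    \int[lebesgue_rV n]_(x in A) (gauss_kernel P x * radial_gauss 0 (2 * P)^-1 x).
Proof.
move=> mA P0; have P20 : 0 < (2 * P)^-1 by rewrite invr_gt0 mulr_gt0.
have int k : (lebesgue_rV n).-integrable A (EFin \o radial_gauss k (2 * P)^-1).
  exact: integrable_radial_gauss.
have intZ (c : R) k : (lebesgue_rV n).-integrable A
    (EFin \o (fun x => c * radial_gauss k (2 * P)^-1 x)).
  by apply: (integrableZl mA c (int k)).
have intD (f g : 'rV[R]_n -> R) : (lebesgue_rV n).-integrable A (EFin \o f) ->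
    (lebesgue_rV n).-integrable A (EFin \o g) ->
    (lebesgue_rV n).-integrable A (EFin \o (fun x => f x + g x)).
  by move=> ff gg; apply: (integrableD mA ff gg).
congr (_ * _); rewrite /radial_moment -mulNr.
rewrite -!RintegralZl// -!RintegralD//; last exact: intD.
by apply: eq_Rintegral => x _; rewrite /gauss_kernel /radial_gauss; ring.
Qed.

End gauss_prob.

(** * Polyhedra and large noise *)

Section cone_shells.
Context {R : realType} {n : nat}.
Implicit Types (A S K : set 'rV[R]_n) (x q v l : 'rV[R]_n) (a b c d : R).

Lemma measurable_homothety_preimage c v A : measurable A ->
  measurable (homothety c v @^-1` A).
Proof.
by move=> mA; rewrite -[X in measurable X]setTI; exact: measurable_homothety.
Qed.

Lemma ge0_integral_homothety c v A (f : 'rV[R]_n -> \bar R) : 0 < c -> measurable A ->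
  measurable_fun setT f -> (forall x, 0 <= f x)%E ->
  (\int[lebesgue_rV n]_(x in homothety c v @^-1` A) f (homothety c v x) =
   (c^-1 ^+ n)%:E * \int[lebesgue_rV n]_(x in A) f x)%E.
Proof.
move=> c0 mA mf f0; have c1 : 0 <= c^-1 ^+ n by rewrite exprn_ge0// invr_ge0 ltW.
rewrite -(ge0_integral_pushforward (measurable_homothety c v))//; last first.
  exact: measurable_funTS.
rewrite -[c^-1 ^+ n]/((NngNum c1)%:num) -ge0_integral_mscale//; last exact: measurable_funTS.
apply: eq_measure_integral => [|mT B mB _]; first exact: measurable_homothety.
by rewrite /= /pushforward /mscale/= lebesgue_rV_homothety.
Qed.

Local Notation gauss := (radial_gauss 0 2^-1).
Local Notation mass A := (radial_moment A 0 2^-1).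

Lemma integral_gauss_homothety_le c v A S : 0 < c -> measurable A -> measurable S ->
  S `<=` homothety c v @^-1` A ->
  (\int[lebesgue_rV n]_(x in S) (gauss (homothety c v x))%:E <=
   (c^-1 ^+ n * mass A)%:E)%E.
Proof.
move=> c0 mA mS SA; have mg : measurable_fun setT (EFin \o @radial_gauss R n 0 2^-1).
  by apply/measurable_EFinP; exact: measurable_radial_gauss.
rewrite EFinM EFin_radial_moment//.
rewrite -(ge0_integral_homothety v c0 mA mg); last first.
  by move=> x; rewrite lee_fin radial_gauss_ge0.
apply: ge0_subset_integral => //.
- exact: measurable_homothety_preimage.
- by apply: measurable_funTS; apply: (measurableT_comp mg); exact: measurable_homothety.
- by move=> x _; rewrite lee_fin radial_gauss_ge0.
Qed.

Definition cone_shell K l a b := K `&` [set x | a < dot l x <= b].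

Lemma measurable_cone_shell K l a b : measurable K -> measurable (cone_shell K l a b).
Proof.
move=> mK; apply: measurableI => //.
rewrite (_ : [set x | _] = dot l @^-1` `]a, b]%classic); last first.
  by apply/seteqP; split => x; rewrite /= in_itv.
by rewrite -[X in measurable X]setTI; exact: measurable_dot.
Qed.

(** Only positive factors are asked for: a cone cut out by strict inequalities does not contain
    0. *)
Definition convex_cone K :=
  (forall x q, K x -> K q -> K (x + q)) /\ (forall c x, 0 < c -> K x -> K (c *: x)).

(* A shell contains its image under the homothety of ratio 1/2 centred at [a *: q]. *)
Lemma cone_shell_second_moment K l q a b : convex_cone K -> measurable K ->
  K q -> dot l q = 1 -> 0 < a -> a <= 1 ->
  radial_moment (cone_shell K l a b) 1 2^-1 <=
    4 * expR (dot q q / 4) * 2 ^+ n * mass (cone_shell K l a b).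
Proof.
move=> [KD KZ] mK Kq lq a0 a1; set S := cone_shell K l a b.
have mS : measurable S by exact: measurable_cone_shell.
have SS : S `<=` homothety 2^-1 (a / 2 *: q) @^-1` S.
  move=> x [Kx /andP[ax xb]]; split => /=.
    by apply: KD; apply: KZ; rewrite ?divr_gt0// invr_gt0.
  by rewrite dotDr !dotZr lq; lra.
(* The exponent at the image point is [|x + a q|^2 / 8], at most [(|x|^2 + a^2 |q|^2) / 4], and
   [a <= 1]. *)
have gle x : expR (- (dot q q / 4)) * radial_gauss 0 4^-1 x <=
    gauss (homothety 2^-1 (a / 2 *: q) x).
  rewrite /radial_gauss !expr0 !mul1r -expRD ler_expR /homothety.
  rewrite !dotDl !dotDr !dotZl !dotZr (dotC q x).
  have := normr_dot_le q x; rewrite ler_norml => /andP[_]; rewrite (dotC q x) => xq.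
  have a_xq : a * dot x q <= (a ^+ 2 * dot q q + dot x x) / 2.
    have := dotxx_ge0 (x + (- a) *: q).
    by rewrite !dotDl !dotDr !dotZl !dotZr (dotC q x); lra.
  have : a ^+ 2 * dot q q <= dot q q.
    by rewrite ler_piMl ?dotxx_ge0// expr_le1// ltW.
  by lra.
have h1 : expR (- (dot q q / 4)) * radial_moment S 0 4^-1 <= 2 ^+ n * mass S.
  have half0 : 0 < 2^-1 :> R by rewrite invr_gt0.
  have := integral_gauss_homothety_le half0 mS mS SS; rewrite invrK => H.
  rewrite -lee_fin; apply: le_trans H.
  rewrite EFinM EFin_radial_moment//.
  rewrite -ge0_integralZl_EFin ?expR_ge0//.
  - apply: ge0_le_integral => //.
    + by move=> x _; rewrite lee_fin mulr_ge0 ?expR_ge0 ?radial_gauss_ge0.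
    + apply/measurable_EFinP; apply: measurable_funM => //.
      by apply: measurable_funTS; exact: measurable_radial_gauss.
    + apply/measurable_EFinP; apply: measurable_funTS.
      by apply: measurableT_comp; [exact: measurable_radial_gauss|exact: measurable_homothety].
    + by move=> x _; rewrite lee_fin.
  - by move=> x _; rewrite lee_fin radial_gauss_ge0.
  - by apply/measurable_EFinP; apply: measurable_funTS; exact: measurable_radial_gauss.
(* From [u <= 4 * expR (u / 4)] with [u = dot x x]: half of the exponent pays for the factor
   [dot x x]. *)
have h2 : radial_moment S 1 2^-1 <= 4 * radial_moment S 0 4^-1.
  have int4 : (lebesgue_rV n).-integrable S (EFin \o radial_gauss 0 4^-1).
    exact: integrable_radial_gauss.
  rewrite -RintegralZl//; apply: le_Rintegral => //.
  - exact: integrable_radial_gauss.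
  - exact: (integrableZl mS 4 int4).
  - move=> x _; rewrite /radial_gauss expr1 expr0 mul1r.
    rewrite (_ : - (2^-1 * _) = - (dot x x / 4) - 4^-1 * dot x x); last by lra.
    rewrite expRD mulrA ler_wpM2r ?expR_ge0// expRN ler_pdivrMr ?expR_gt0//.
    by have := expR_ge1Dx (dot x x / 4); lra.
apply: le_trans h2 _; rewrite -!mulrA ler_wpM2l//.
move: h1; rewrite expRN ler_pdivrMl ?expR_gt0//.
Qed.

(** If [q] is a point of the cone at level 1, translation by [d *: q] sends the lower shell into the
    upper one. The density drops by at most a multiple of [d * (dot q q + dot x x)], and the second
    moment bound turns this loss into a multiple of [d] times the mass. *)
Lemma cone_shell_translate K l : convex_cone K -> measurable K ->
  exists2 C, 0 <= C & forall a b d, 0 < a -> a <= b -> 0 <= d -> b + d <= 1 ->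
    (1 - C * d) * mass (cone_shell K l a b) <= mass (cone_shell K l (a + d) (b + d)).
Proof.
move=> cK mK; have [KD KZ] := cK.
have [[q Kq lq]|noq] := pselect (exists2 q, K q & dot l q = 1); last first.
  (* Without such a [q] the cone has no point at a positive level, since it could be rescaled to
     level 1; the lower shell is empty. *)
  exists 0 => // a b d a0 ab d0 bd1; rewrite mul0r subr0 mul1r.
  rewrite (_ : cone_shell K l a b = set0).
    by rewrite /radial_moment Rintegral_set0 radial_moment_ge0.
  apply/seteqP; split => // x [Kx /andP[ax _]]; apply: noq.
  have x0 : 0 < dot l x by exact: lt_trans ax.
  exists ((dot l x)^-1 *: x); first by apply: KZ => //; rewrite invr_gt0.
  by rewrite dotZr mulVf// gt_eqF.
set C0 := 4 * expR (dot q q / 4) * 2 ^+ n.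
have C00 : 0 <= C0 by rewrite !mulr_ge0// ?expR_ge0// exprn_ge0.
(* The coefficients, divided by [d], of the two error terms in [gle] below, once the second moment
   is bounded by [C0] times the mass. *)
exists (dot q q + C0 / 2); first by rewrite addr_ge0 ?dotxx_ge0// divr_ge0.
move=> a b d a0 ab d0 bd1.
set S := cone_shell K l a b; set S' := cone_shell K l _ _.
have mS : measurable S by exact: measurable_cone_shell.
have mS' : measurable S' by exact: measurable_cone_shell.
have moment2 : radial_moment S 1 2^-1 <= C0 * mass S.
  by apply: cone_shell_second_moment => //; lra.
have SS : S `<=` homothety 1 (d *: q) @^-1` S'.
  move=> x [Kx /andP[ax xb]]; split; rewrite /homothety scale1r /=.
    move: d0; rewrite le_eqVlt => /predU1P[<-|d0]; first by rewrite scale0r addr0.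
    by apply: KD => //; exact: KZ.
  by rewrite dotDr !dotZr lq; lra.
have d1 : d <= 1 by lra.
(* Translation multiplies the density by an exponential, bounded below by [1 + y <= expR y]; then
   [dot x q <= (dot q q + dot x x) / 2] and [d * d <= d]. *)
have gle x : gauss x <= gauss (homothety 1 (d *: q) x) +
    (d * dot q q * gauss x + d / 2 * radial_gauss 1 2^-1 x).
  rewrite /radial_gauss expr1 !expr0 !mul1r /homothety scale1r.
  rewrite !dotDl !dotDr !dotZl !dotZr (dotC q x).
  set g := expR (- (2^-1 * dot x x)).
  rewrite (_ : - (2^-1 * _) = - (2^-1 * dot x x) +
    (- (d * dot x q) - d * d * dot q q / 2)); last by lra.
  rewrite expRD -/g.
  have E := expR_ge1Dx (- (d * dot x q) - d * d * dot q q / 2).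
  have := normr_dot_le q x; rewrite ler_norml => /andP[_]; rewrite (dotC q x) => xq.
  have dxq : d * dot x q <= d * ((dot q q + dot x x) / 2) by rewrite ler_wpM2l.
  have ddq : d * d * dot q q <= d * dot q q.
    by rewrite ler_wpM2r ?dotxx_ge0// ler_piMr.
  have g0 : 0 <= g by exact: expR_ge0.
  set e := expR (- (d * dot x q) - _) in E *.
  have : 0 <= g * (e + d * dot q q + d / 2 * dot x x - 1) by rewrite mulr_ge0//; lra.
  by lra.
have mg k : measurable_fun S (fun x : 'rV[R]_n => (radial_gauss k 2^-1 x)%:E).
  by apply/measurable_EFinP; apply: measurable_funTS; exact: measurable_radial_gauss.
have mgT : measurable_fun S (fun x : 'rV[R]_n => (gauss (homothety 1 (d *: q) x))%:E).
  apply/measurable_EFinP; apply: measurable_funTS.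
  by apply: measurableT_comp; [exact: measurable_radial_gauss|exact: measurable_homothety].
have dq0 : 0 <= d * dot q q by rewrite mulr_ge0 ?dotxx_ge0.
have dh0 : 0 <= d / 2 by rewrite divr_ge0.
have mgZ c k : measurable_fun S (fun x : 'rV[R]_n => c%:E * (radial_gauss k 2^-1 x)%:E)%E.
  by apply: emeasurable_funM => //; exact: mg.
have gZ0 c k x : 0 <= c -> (0 <= c%:E * (radial_gauss k 2^-1 x)%:E)%E.
  by move=> c0; rewrite mule_ge0// lee_fin radial_gauss_ge0.
have rest : (\int[lebesgue_rV n]_(x in S) ((d * dot q q)%:E * (gauss x)%:E +
      (d / 2)%:E * (radial_gauss 1 2^-1 x)%:E) =
    (d * dot q q * mass S + d / 2 * radial_moment S 1 2^-1)%:E)%E.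
  rewrite ge0_integralD//; try by move=> x _; exact: gZ0.
  rewrite !ge0_integralZl_EFin//; try by move=> x _; rewrite lee_fin radial_gauss_ge0.
  by rewrite EFinD !EFinM !EFin_radial_moment.
have : mass S <= mass S' + (d * dot q q * mass S + d / 2 * radial_moment S 1 2^-1).
  rewrite -lee_fin EFinD -rest EFin_radial_moment//.
  have := integral_gauss_homothety_le ltr01 mS' mS SS; rewrite invr1 expr1n mul1r => H.
  apply: (@le_trans _ _ (\int[lebesgue_rV n]_(x in S)
      ((gauss (homothety 1 (d *: q) x))%:E +
      ((d * dot q q)%:E * (gauss x)%:E + (d / 2)%:E * (radial_gauss 1 2^-1 x)%:E)))%E).
    apply: ge0_le_integral => //.
    - by move=> x _; rewrite lee_fin radial_gauss_ge0.
    - by apply: emeasurable_funD => //; exact: emeasurable_funD.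
    - by move=> x _; rewrite -!EFinM -!EFinD lee_fin.
  rewrite ge0_integralD//.
  - by rewrite leeD2r.
  - by move=> x _; rewrite lee_fin radial_gauss_ge0.
  - by move=> x _; rewrite adde_ge0// gZ0.
  - exact: emeasurable_funD.
have := ler_wpM2l dh0 moment2.
by lra.
Qed.

End cone_shells.

(** * Polyhedra cut into cones over their facets *)

Section polyhedron.
Context {R : realType} {n M : nat}.
Variable w : 'I_M -> 'rV[R]_n.
Implicit Types (a b c d t : R) (j k : 'I_M) (x : 'rV[R]_n).

Definition polyhedron t : set 'rV[R]_n := [set x | forall j, dot (w j) x <= t].

Lemma measurable_dot_le v t : measurable [set x : 'rV[R]_n | dot v x <= t].
Proof.
rewrite (_ : [set x | _] = dot v @^-1` `]-oo, t]%classic); last first.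
  by apply/seteqP; split => x; rewrite /= in_itv.
by rewrite -[X in measurable X]setTI; exact: measurable_dot.
Qed.

Lemma measurable_dot_lt v t : measurable [set x : 'rV[R]_n | dot v x < t].
Proof.
rewrite (_ : [set x | _] = dot v @^-1` `]-oo, t[%classic); last first.
  by apply/seteqP; split => x; rewrite /= in_itv.
by rewrite -[X in measurable X]setTI; exact: measurable_dot.
Qed.

Lemma measurable_forall_ord (F : 'I_M -> set 'rV[R]_n) :
  (forall j, measurable (F j)) -> measurable [set x | forall j, F j x].
Proof.
move=> mF; rewrite (_ : mkset _ = \bigcap_(j in [set: 'I_M]) F j).
  by apply: fin_bigcap_measurable => [|j _]; [exact: finite_finset|exact: mF].
by apply/seteqP; split => x /= Fx j; [move=> _|]; exact: Fx.
Qed.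

Lemma measurable_polyhedron t : measurable (polyhedron t).
Proof. by apply: measurable_forall_ord => j; exact: measurable_dot_le. Qed.

(* Ties between the facets are broken by the order of the indices, so that the
   cones are disjoint. *)
Definition facet_cone j : set 'rV[R]_n := [set x | forall k,
  dot (w k + (- 1) *: w j) x <= 0 /\ ((k < j)%N -> dot (w k + (- 1) *: w j) x < 0)].

Lemma facet_coneP j x : facet_cone j x <->
  forall k, dot (w k) x <= dot (w j) x /\ ((k < j)%N -> dot (w k) x < dot (w j) x).
Proof.
split=> h k; have [h1 h2] := h k; split=> [|kj]; rewrite ?dotDl ?dotZl.
- by move: h1; rewrite dotDl dotZl; lra.
- by move: (h2 kj); rewrite dotDl dotZl; lra.
- by lra.
- by have := h2 kj; lra.
Qed.

Lemma measurable_facet_cone j : measurable (facet_cone j).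
Proof.
apply: measurable_forall_ord => k; case: (ltnP k j) => kj.
  rewrite [X in measurable X](_ : _ = [set x | dot (w k + (- 1) *: w j) x < 0]).
    exact: measurable_dot_lt.
  by apply/seteqP; split => x /= => [[_ /(_ isT)]//|h]; split => //; exact: ltW.
rewrite [X in measurable X](_ : _ = [set x | dot (w k + (- 1) *: w j) x <= 0]).
  exact: measurable_dot_le.
by apply/seteqP; split => x /= => [[]//|h]; split.
Qed.

Lemma convex_cone_facet_cone j : convex_cone (facet_cone j).
Proof.
split=> [x y|c x c0] Kx => [Ky|] k; split => [|kj].
- by rewrite dotDr; have [h _] := Kx k; have [h' _] := Ky k; lra.
- by rewrite dotDr; have [_ /(_ kj) h] := Kx k; have [_ /(_ kj) h'] := Ky k; lra.
- by rewrite dotZr; have [h _] := Kx k; rewrite pmulr_rle0.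
- by rewrite dotZr; have [_ /(_ kj) h] := Kx k; rewrite pmulr_rlt0.
Qed.

Definition facet_shell a b j := cone_shell (facet_cone j) (w j) a b.

Lemma measurable_facet_shell a b j : measurable (facet_shell a b j).
Proof. by apply: measurable_cone_shell; exact: measurable_facet_cone. Qed.

Lemma trivIset_facet_shell a b (D : set 'I_M) : trivIset D (facet_shell a b).
Proof.
move=> j k _ _ [x [[/facet_coneP Kj _] [/facet_coneP Kk _]]].
apply: ord_inj; have [jk|kj|//] := ltngtP j k; exfalso.
- by have [_ /(_ jk)] := Kk j; have [+ _] := Kj k; lra.
- by have [_ /(_ kj)] := Kj k; have [+ _] := Kk j; lra.
Qed.

(** Among the forms that are largest at [x], the one of smallest index is taken. *)
Lemma exists_facet_cone x : (0 < M)%N -> exists j, facet_cone j x.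
Proof.
move=> M0; pose j0 : 'I_M := Ordinal M0.
have P0 : [forall k, dot (w k) x <= dot (w [arg max_(j > j0) dot (w j) x]%O) x].
  by apply/forallP => k; case: arg_maxP => // j _; exact.
have [j Pj jmin] := @arg_minnP _ _ (fun j => [forall k, dot (w k) x <= dot (w j) x])
  (fun j => nat_of_ord j) P0.
exists j; apply/facet_coneP => k; split; first by move/forallP : Pj.
move=> kj; rewrite ltNge; apply/negP => jk.
have : (j <= k)%N by apply: jmin; apply/forallP => l; apply: le_trans jk; move/forallP : Pj.
by rewrite leqNgt kj.
Qed.

(** A point is in the polyhedron of level [t] when its largest form is at most [t]; the points
    gained from [a] to [b] are sorted by the form attaining the maximum. *)
Lemma polyhedron_facet_shells a b : (0 < M)%N -> a <= b ->
  polyhedron b = polyhedron a `|` \big[setU/set0]_(j < M) facet_shell a b j.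
Proof.
move=> M0 ab; apply/seteqP; split => [x xb|x].
  have [j Kj] := exists_facet_cone x M0.
  have [ja|ja] := leP (dot (w j) x) a; [left=> k|right].
    by move/facet_coneP : Kj => /(_ k)[h _]; exact: le_trans ja.
  by rewrite -bigcup_seq; exists j; [rewrite /= mem_index_enum|split => //; rewrite /= ja xb].
move=> [xa j|]; first exact: le_trans ab.
rewrite -bigcup_seq => -[j _ [/facet_coneP Kj /andP[_ jb]]] k.
by have [h _] := Kj k; exact: le_trans jb.
Qed.

Local Notation mass A := (radial_moment A 0 2^-1).

Lemma mass_polyhedron a b : (0 < M)%N -> a <= b ->
  mass (polyhedron b) = mass (polyhedron a) + \sum_(j < M) mass (facet_shell a b j).
Proof.
move=> M0 ab; have h0 : 0 < 2^-1 :> R by rewrite invr_gt0.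
have mU : measurable (\big[setU/set0]_(j < M) facet_shell a b j).
  by apply: bigsetU_measurable => j _; exact: measurable_facet_shell.
rewrite (polyhedron_facet_shells M0 ab) radial_momentU//; last 2 first.
- exact: measurable_polyhedron.
- apply/seteqP; split => // x [xa]; rewrite -bigcup_seq => -[j _ [_ /andP[aj _]]].
  by have := xa j; lra.
congr (_ + _); apply: EFin_inj.
rewrite EFin_radial_moment// -sumEFin ge0_integral_bigsetU//.
- by apply: eq_bigr => j _; rewrite EFin_radial_moment//; exact: measurable_facet_shell.
- by move=> j; exact: measurable_facet_shell.
- exact: index_enum_uniq.
- exact: trivIset_facet_shell.
- by apply/measurable_EFinP; apply: measurable_funTS; exact: measurable_radial_gauss.
- by move=> x _; rewrite lee_fin radial_gauss_ge0.
Qed.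

Lemma mass_polyhedron_increment : (0 < M)%N -> exists2 C, 0 <= C &
  forall a b d, 0 < a -> a <= b -> 0 <= d -> b + d <= 1 ->
    (1 - C * d) * (mass (polyhedron b) - mass (polyhedron a)) <=
    mass (polyhedron (b + d)) - mass (polyhedron (a + d)).
Proof.
move=> M0.
have /choice[C Cw] : forall j, exists c, 0 <= c /\
    forall a b d, 0 < a -> a <= b -> 0 <= d -> b + d <= 1 ->
      (1 - c * d) * mass (facet_shell a b j) <= mass (facet_shell (a + d) (b + d) j).
  move=> j; have [c c0 cw] := @cone_shell_translate _ _ (facet_cone j) (w j)
    (convex_cone_facet_cone j) (measurable_facet_cone j).
  by exists c.
exists (\sum_j C j) => [|a b d a0 ab d0 bd].
  by apply: sumr_ge0 => j _; have [] := Cw j.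
rewrite (mass_polyhedron M0 ab) (@mass_polyhedron (a + d) (b + d))// ?lerD2r//.
rewrite ![_ + \sum_(_ < _) _]addrC !addrK mulr_sumr; apply: ler_sum => j _.
have [_ /(_ a b d a0 ab d0 bd)] := Cw j; apply: le_trans.
rewrite ler_wpM2r ?radial_moment_ge0// lerD2l lerN2 ler_wpM2r//.
rewrite (bigD1 j)//= lerDl; apply: sumr_ge0 => k _; by have [] := Cw k.
Qed.

(** Scaling space by [t] turns noise of power [t^-2] into standard noise and the polyhedron of level
    1 into that of level [t]. *)
Lemma gauss_prob_polyhedron t : 0 < t ->
  gauss_prob (polyhedron 1) (t * t)^-1 = (2 * pi) `^ (- (n%:R / 2)) * mass (polyhedron t).
Proof.
move=> t0; have tt0 : 0 < t * t by rewrite mulr_gt0.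
have P0 : 0 < (t * t)^-1 by rewrite invr_gt0.
have h0 : 0 < 2^-1 :> R by rewrite invr_gt0.
rewrite gauss_probE//; last exact: measurable_polyhedron.
congr (_ * _); rewrite /gauss_term.
have -> : (t * t)^-1 `^ (- (n%:R / 2)) = t ^+ n.
  rewrite -powR_inv1 ?ltW// -powRrM mulN1r opprK -expr2 -powR_mulrn ?ltW// -powRrM.
  by rewrite mulrC divfK// powR_mulrn// ltW.
have -> : (2 * (t * t)^-1)^-1 = t * t / 2 by rewrite invfM invrK mulrC.
have tt20 : 0 < t * t / 2 by rewrite divr_gt0.
have mg : measurable_fun setT (EFin \o @radial_gauss R n 0 2^-1).
  by apply/measurable_EFinP; exact: measurable_radial_gauss.
have g0 x : (0 <= (EFin \o @radial_gauss R n 0 2^-1) x)%E.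
  by rewrite lee_fin radial_gauss_ge0.
have E := ge0_integral_homothety 0 t0 (measurable_polyhedron t) mg g0.
apply: EFin_inj; rewrite [in RHS]EFin_radial_moment//; last exact: measurable_polyhedron.
rewrite EFinM EFin_radial_moment//; last exact: measurable_polyhedron.
transitivity ((t ^+ n)%:E * ((t^-1 ^+ n)%:E *
    \int[lebesgue_rV n]_(x in polyhedron t) (radial_gauss 0 2^-1 x)%:E))%E.
  rewrite -E (_ : _ @^-1` _ = polyhedron 1).
    congr (_ * _)%E; apply: eq_integral => x _ /=.
    rewrite /radial_gauss !expr0 !mul1r /homothety addr0 dotZl dotZr.
    by congr ((expR (- _))%:E); lra.
  have e (y : R) : (t * y <= t) = (y <= 1) by rewrite -{2}[t]mulr1 ler_pM2l.
  by apply/seteqP; split => x xP j; have := xP j; rewrite /homothety addr0 dotZr e.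
by rewrite muleA -EFinM exprVn mulfV ?mul1e// expf_neq0// gt_eqF.
Qed.

End polyhedron.

(** * Sign of the second derivative for large noise *)

Section large_noise.
Context {R : realType} {n M : nat}.
Variable w : 'I_M -> 'rV[R]_n.
Hypothesis M_gt0 : (0 < M)%N.
Implicit Types (a b c d t P : R).
Local Notation Omega := (polyhedron w 1).
Local Notation mOmega := (measurable_polyhedron w 1).

(** [B] is the probability in the variable [t], where [P = t^-2], and [E] its derivative by the
    chain rule. *)
Let B t := gauss_prob Omega (t * t)^-1.
Let E t := gauss_prob1 Omega (t * t)^-1 * (- ((t * t) ^- 2 * (t + t))).

Let is_derive_B t : 0 < t -> is_derive t 1 B (E t).
Proof.
move=> t0; have tt0 : 0 < (t * t)^-1 by rewrite invr_gt0 mulr_gt0.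
have tt : t * t != 0 by rewrite mulf_neq0 ?gt_eqF.
have d := @is_derive1V _ (fun u => u * u) t _ tt
  (is_derive1M (is_derive_id t (1 : R)) (is_derive_id t (1 : R))).
have := @is_derive1_comp _ (gauss_prob Omega) (fun u => (u * u)^-1) t _ _
  (is_derive_gauss_prob mOmega tt0) d.
by move/is_derive_eq; apply; rewrite /E mul1r mulr1.
Qed.

Let B_increment : exists2 C, 0 <= C &
  forall a b d, 0 < a -> a <= b -> 0 <= d -> b + d <= 1 ->
    (1 - C * d) * (B b - B a) <= B (b + d) - B (a + d).
Proof.
have [C C0 CA] := mass_polyhedron_increment w M_gt0; exists C => // a b d a0 ab d0 bd.
have b0 : 0 < b by exact: lt_le_trans ab.
rewrite /B !gauss_prob_polyhedron ?ltr_wpDr// -!mulrBr mulrCA.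
by rewrite ler_wpM2l ?powR_ge0//; exact: CA.
Qed.

Let B_ndecr a b : 0 < a -> a <= b -> B a <= B b.
Proof.
move=> a0 ab; rewrite /B !gauss_prob_polyhedron// ?(lt_le_trans a0)//.
rewrite ler_wpM2l ?powR_ge0// (mass_polyhedron w M_gt0 ab) lerDl.
by apply: sumr_ge0 => j _; exact: radial_moment_ge0.
Qed.

Let E_ge0 t : 0 < t -> 0 <= E t.
Proof.
move=> t0; have d0 : is_derive t 1 (fun=> 0 : R) (0 : R) by exact: is_derive_cst.
apply: (is_derive_le ltr01 d0 (is_derive_B t0)) => h /andP[h0 _].
by rewrite subrr subr_ge0 B_ndecr// lerDl ltW.
Qed.

(** [B_increment] between [a] and [a + h], divided by [h], in the limit of small [h] with [d]
    fixed. *)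
Let E_increment : exists2 C, 0 <= C &
  forall a d, 0 < a -> 0 <= d -> a + d < 1 -> (1 - C * d) * E a <= E (a + d).
Proof.
have [C C0 CB] := B_increment; exists C => // a d a0 d0 ad1.
have ad0 : 0 < a + d by rewrite ltr_wpDr.
have e0 : 0 < 1 - (a + d) by rewrite subr_gt0.
apply: (is_derive_le e0 (is_derive1Z (1 - C * d) (is_derive_B a0)) (is_derive_B ad0)).
move=> h /andP[h0 h1]; rewrite -mulrBr [a + d + h]addrAC; apply: CB => //; lra.
Qed.

(** At [P = t^-2] the first derivative is [- (t ^+ 3 * E t / 2)]. For small [t] the possible
    decrease of [E] is outweighed by the growth of [t ^+ 3], so the first derivative is
    nondecreasing in [P] for large [P]. *)
Lemma gauss_prob2_polyhedron_large :
  exists2 U, 0 < U & forall P, U <= P -> 0 <= gauss_prob2 Omega P.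
Proof.
have [C C0 CE] := E_increment.
have U0 : 0 < C + 2 by rewrite ltr_wpDl.
(* In terms of [t] this bound reads [(C + 2) * t <= 1], which gives both [C * t <= 1] and
   [t < 1]. *)
exists ((C + 2) ^+ 2); first by rewrite exprn_gt0.
have key P : (C + 2) ^+ 2 <= P -> exists t, [/\ 0 < t, (C + 2) * t <= 1 & P = (t * t)^-1].
  move=> UP; have P0 : 0 < P by rewrite (lt_le_trans _ UP)// exprn_gt0.
  exists (Num.sqrt P)^-1; rewrite invr_gt0 sqrtr_gt0 P0; split => //.
    rewrite ler_pdivrMr ?sqrtr_gt0// mul1r -(ger0_norm (ltW U0)) -sqrtr_sqr.
    by rewrite ler_wsqrtr.
  by rewrite invfM !invrK -expr2 sqr_sqrtr// ltW.
have p1_ndecr P h : (C + 2) ^+ 2 <= P -> 0 < h -> gauss_prob1 Omega P <= gauss_prob1 Omega (P + h).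
  move=> UP h0; have [t [t0 Ut Pt]] := key _ UP.
  have [|a [a0 Ua Pa]] := key (P + h); first by rewrite (le_trans UP)// lerDl ltW.
  have at_ : a < t.
    have : (t * t)^-1 < (a * a)^-1 by rewrite -Pt -Pa ltrDl.
    rewrite ltf_pV2 ?posrE ?mulr_gt0// => aatt.
    by rewrite ltNge; apply/negP => ta; have := ler_pM (ltW t0) (ltW t0) ta ta; lra.
  have pE u : 0 < u -> gauss_prob1 Omega (u * u)^-1 = - (u ^+ 3 * E u / 2).
    by move=> u0; rewrite /E; field; rewrite gt_eqF.
  rewrite Pa Pt !pE// lerN2 ler_pM2r ?invr_gt0//.
  have t1 : t < 1.
    have : 0 <= C * t by rewrite mulr_ge0// ltW.
    by lra.
  have := CE a (t - a) a0 _; rewrite subr_ge0 (ltW at_) addrC subrK => /(_ isT t1) CEa.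
  have t30 : 0 <= t ^+ 3 by rewrite exprn_ge0// ltW.
  apply: le_trans (ler_wpM2l t30 CEa); rewrite [leRHS]mulrA ler_wpM2r ?E_ge0//.
  have Ct1 : C * t <= 1 by lra.
  (* The product equals [t ^+ 3 * (1 - C * (t - a)) - a ^+ 3]. *)
  have : 0 <= (t - a) * (t * t * (1 - C * t) + t * a + a * a).
    by rewrite mulr_ge0 ?subr_ge0 ?(ltW at_)// !addr_ge0 ?mulr_ge0 ?subr_ge0 ?(ltW a0) ?(ltW t0).
  by rewrite -subr_ge0; congr (_ <= _); ring.
move=> P UP; have P0 : 0 < P by rewrite (lt_le_trans _ UP)// exprn_gt0.
have d0 : is_derive P 1 (fun=> 0 : R) (0 : R) by exact: is_derive_cst.
apply: (is_derive_le ltr01 d0 (is_derive_gauss_prob1 mOmega P0)) => h /andP[h0 _].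
by rewrite subrr subr_ge0 p1_ndecr.
Qed.

End large_noise.

(** * The decision region *)

Section positivity.
Context {R : realType}.

Lemma Rintegral_gt0 (d : measure_display) (T : measurableType d)
    (mu : {measure set T -> \bar R}) (D : set T) (f : T -> R) :
  measurable D -> mu.-integrable D (EFin \o f) -> (forall x, D x -> 0 < f x) ->
  mu D != 0%E -> 0 < \int[mu]_(x in D) f x.
Proof.
move=> mD intf f0; have [//|I0 /negP[]] := ltP 0 (\int[mu]_(x in D) f x).
have f0' x : D x -> 0 <= f x by move=> /f0/ltW.
have {}I0 : (\int[mu]_(x in D) `|(EFin \o f) x| = 0)%E.
  transitivity (\int[mu]_(x in D) (f x)%:E)%E.
    by apply: eq_integral => x /set_mem Dx /=; rewrite ger0_norm// f0'.
  have : \int[mu]_(x in D) f x = 0 by apply/le_anti; rewrite I0 Rintegral_ge0.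
  move=> E0; rewrite -[RHS]/(0%R%:E) -E0 /Rintegral fineK//.
  exact: integrable_fin_num.
move/(ae_eq_integral_abs mu mD (measurable_int mu intf)) : I0 => [N [mN N0 DN]].
rewrite -measure_le0 -N0 le_measure ?inE// => x Dx; apply: DN => /= /(_ Dx) [] fx0.
by have := f0 x Dx; rewrite fx0 ltxx.
Qed.

(** Translates of the half-space along [v] cover the space; were it null, the whole space would be
    null, against its Gaussian mass 1. *)
Lemma halfspace_measure_neq0 n (v : 'rV[R]_n) c : v != 0 ->
  lebesgue_rV n [set x | c < dot v x] != 0%E.
Proof.
move=> v0; have vv0 : 0 < dot v v by rewrite lt_neqAle eq_sym dotxx_eq0 v0 dotxx_ge0.
have mH b : measurable [set x : 'rV[R]_n | b < dot v x].
  rewrite (_ : [set x | _] = dot v @^-1` `]b, +oo[%classic); last first.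
    by apply/seteqP; split => x; rewrite /= in_itv/= andbT.
  by rewrite -[X in measurable X]setTI; exact: measurable_dot.
apply/eqP => H0.
have T0 : (lebesgue_rV n).-negligible [set: 'rV[R]_n].
  pose F k := homothety 1 ((k%:R / dot v v) *: v) @^-1` [set x | c < dot v x].
  apply: (@negligibleS _ _ _ _ (\bigcup_k F k)); last first.
    apply: negligible_bigcup => k.
    have Fk0 : lebesgue_rV n (F k) = 0%E by rewrite /F lebesgue_rV_homothety// H0 mule0.
    by apply/negligibleP => //; exact: measurable_homothety_preimage.
  move=> x _; exists (Num.truncn `|c - dot v x|).+1 => //.
  rewrite /F /= /homothety scale1r dotDr dotZr divfK ?gt_eqF//.
  have : `|c - dot v x| < (Num.truncn `|c - dot v x|).+1%:R by apply: truncnS_gt.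
  by rewrite ltr_norml; lra.
move: T0 => /negligibleP => /(_ measurableT) T0.
have := gauss_prob_setT (ltr01 : 0 < 1 :> R) (n := n).
rewrite /gauss_prob /Rintegral null_set_integral//.
- by move/eqP; rewrite /= eq_sym oner_eq0.
- apply/measurable_EFinP; rewrite (_ : gauss_density 1 = fun x =>
      (2 * pi) `^ (- (n%:R / 2)) * 1 `^ (- (n%:R / 2)) * radial_gauss 0 (2 * 1)^-1 x).
    by apply: measurable_funM => //; exact: measurable_radial_gauss.
  by apply/funext => x; exact: gauss_densityE.
Qed.

End positivity.

(** * Decision region: facets and distances to the boundary *)

Section decision_region_geometry.
Context {R : realType} {n M : nat}.
Variables (s : 'I_M -> 'rV[R]_n) (i : 'I_M).
Hypothesis hs : constellation s.
Implicit Types (x : 'rV[R]_n) (j : 'I_M).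

(* [facet_form i] is 0 because of [0^-1 = 0], so that the constraint of index [i] is vacuous. *)
Definition facet_form j := (facet_dist s i j)^-1 *: facet_normal s i j.

Let sij j : j != i -> 0 < enorm (s j - s i).
Proof.
move=> ji; rewrite sqrtr_gt0 lt_neqAle dotxx_ge0 andbT eq_sym dotxx_eq0 subr_eq0.
by apply: contra_neq ji; case: hs => _ + _; exact.
Qed.

Lemma facet_dist_gt0 j : j != i -> 0 < facet_dist s i j.
Proof. by move=> /sij ?; rewrite mulr_gt0// invr_gt0. Qed.

Lemma dot_facet_normal j : j != i -> dot (facet_normal s i j) (facet_normal s i j) = 1.
Proof.
move=> /sij d0; rewrite /facet_normal dotZl dotZr -sqr_enorm; field.
by rewrite gt_eqF.
Qed.

Lemma decision_regionE : decision_region s i = polyhedron facet_form 1.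
Proof.
apply/seteqP; split => x xP j.
  have [->|ji] := eqVneq j i.
    by rewrite /facet_form /facet_normal subrr !scaler0 /dot big1// => k _; rewrite mxE mul0r.
  by rewrite dotZl ler_pdivrMl ?facet_dist_gt0// mulr1; exact: xP.
by move=> ji; have := xP j; rewrite dotZl ler_pdivrMl ?facet_dist_gt0// mulr1.
Qed.

Lemma measurable_decision_region : measurable (decision_region s i).
Proof. by rewrite decision_regionE; exact: measurable_polyhedron. Qed.

Lemma exists_neighbour : exists j, j != i.
Proof.
have [M2 _ _] := hs.
have [i0|i0] := eqVneq (val i) 0%N.
  by exists (Ordinal M2); apply/eqP => /(congr1 val)/=; rewrite i0.
by exists (Ordinal (ltnW M2)); apply: contra_neq i0 => <-.
Qed.

Lemma dmin_le j : j != i -> dmin s i <= facet_dist s i j.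
Proof.
move=> ji; apply: ge_inf; last by exists j.
by exists 0 => _ [k /= ki <-]; exact/ltW/facet_dist_gt0.
Qed.

Lemma dmin_gt0 : 0 < dmin s i.
Proof.
have [j0 j0i] := exists_neighbour.
case: (@arg_minP _ _ _ j0 (fun j => j != i) (facet_dist s i) j0i) => j ji jmin.
apply: lt_le_trans (facet_dist_gt0 ji) _; apply: lb_le_inf.
  by exists (facet_dist s i j0), j0.
by move=> _ [k /= ki <-]; exact: jmin.
Qed.

(** A point outside violates a facet inequality, so its component along that unit normal already
    exceeds [dmin]. *)
Lemma dmin_lt_notin x : ~ decision_region s i x -> dmin s i ^+ 2 < dot x x.
Proof.
move=> /existsNP[j /not_implyP[ji /negP]]; rewrite -ltNge => bx.
have dx : dmin s i < dot (facet_normal s i j) x by exact: le_lt_trans (dmin_le ji) bx.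
apply: lt_le_trans (dot_sqr_le x (dot_facet_normal ji)).
by rewrite ltr_pXn2r// nnegrE ltW// ?dmin_gt0// (lt_trans dmin_gt0).
Qed.

(** Pushing [x] outwards along its ray until a facet is met gives a boundary point at least as far
    from the origin. *)
Lemma enorm_le_dmax x : bounded_set (decision_region s i) -> decision_region s i x ->
  x != 0 -> ((enorm x)%:E <= dmax s i)%E.
Proof.
move=> bD Dx x0; rewrite /dmax; case: asboolP => // _.
have {Dx} Px : polyhedron facet_form 1 x by rewrite -decision_regionE.
(* If no form were positive at [x], the whole ray through [x] would lie in the region, against
   boundedness. *)
have [j0 j0x] : exists j, 0 < dot (facet_form j) x.
  apply: contrapT => /forallNP nj; have [K [_ bK]] := bD.
  have Db y : decision_region s i y -> `|y| <= `|K| + 1.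
    by apply: bK; rewrite ltr_pwDr ?ler_norm.
  have nx0 : 0 < `|x| by rewrite normr_gt0.
  pose t := (`|K| + 2) / `|x|; have t0 : 0 < t by rewrite divr_gt0// ltr_wpDl.
  have : decision_region s i (t *: x).
    rewrite decision_regionE => j; rewrite dotZr.
    have := nj j; move/negP; rewrite -leNgt => jx.
    by rewrite (le_trans _ ler01)// pmulr_rle0.
  by move/Db; rewrite normrZ gtr0_norm// divfK ?gt_eqF//; lra.
pose j1 := [arg max_(j > j0) dot (facet_form j) x]%O.
have j1max j : dot (facet_form j) x <= dot (facet_form j1) x.
  by rewrite /j1; case: arg_maxP => // k _; exact.
have j1x : 0 < dot (facet_form j1) x by exact: lt_le_trans (j1max j0).
set m := dot (facet_form j1) x in j1x j1max.
have m1 : m <= 1 by exact: Px.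
pose y := m^-1 *: x.
have yD : decision_region s i y.
  by rewrite decision_regionE => j; rewrite dotZr ler_pdivrMl// mulr1.
apply: (@le_trans _ _ (enorm y)%:E).
  rewrite lee_fin /enorm ler_wsqrtr// dotZl dotZr mulrA.
  by rewrite ler_peMl ?dotxx_ge0// -expr2 exprn_ege1// invf_ge1.
apply: ereal_sup_ubound; exists y => //; split; first exact: subset_closure.
(* Any point beyond [y] on the ray gives the form [j1] a value above 1, so [y] is not interior. *)
move=> /= yint.
have cvgy : y + h *: x @[h --> (0 : R)] --> y.
  rewrite -[X in _ --> X]addr0 -(scale0r x).
  by apply: cvgD; [exact: cvg_cst|apply: cvgZr_tmp; exact: cvg_id].
have nearD : \forall h \near 0^'+, decision_region s i (y + h *: x).
  by apply: cvg_within; exact: cvgy.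
have [h [h0 Dh]] : exists h : R, 0 < h /\ decision_region s i (y + h *: x).
  by apply: (@filter_ex _ (0:R)^'+); apply: filterI => //; exact: nbhs_right_gt.
move: Dh; rewrite decision_regionE => /(_ j1); rewrite dotDr !dotZr -/m mulVf ?gt_eqF//.
by have := mulr_gt0 h0 j1x; lra.
Qed.

End decision_region_geometry.

(** * Sign and zeros of the second derivative *)

Section second_derivative.
Context {R : realType} {n : nat}.
Implicit Types (A : set 'rV[R]_n) (x : 'rV[R]_n) (P t : R).
Local Notation nu := (n%:R / 2 : R).
Local Notation m := (n%:R + 2 : R).
Local Notation r := (Num.sqrt (2 * m) : R).

Lemma integrable_gauss_kernel A P t : measurable A -> 0 < t ->
  (lebesgue_rV n).-integrable A (EFin \o (fun x => gauss_kernel P x * radial_gauss 0 t x)).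
Proof.
move=> mA t0; have int k : (lebesgue_rV n).-integrable A (EFin \o radial_gauss k t).
  exact: integrable_radial_gauss.
rewrite (_ : EFin \o _ = (fun x => (EFin \o radial_gauss 2 t) x +
    (- (2 * m * P))%:E * (EFin \o radial_gauss 1 t) x +
    (n%:R * m * P ^+ 2)%:E * (EFin \o radial_gauss 0 t) x)%E).
  by apply: integrableD => //; [apply: integrableD => //|]; apply: integrableZl.
apply/funext => x /=; rewrite -!EFinM -!EFinD; congr EFin.
by rewrite /gauss_kernel /radial_gauss; ring.
Qed.

(** The roots multiply to [n * m] because [m ^+ 2 - 2 * m = n * m] for [m = n + 2]. They are the
    source of the two thresholds. *)
Lemma gauss_kernelE P x :
  gauss_kernel P x = (dot x x - (m - r) * P) * (dot x x - (m + r) * P).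
Proof.
have r2 : r ^+ 2 = 2 * m by rewrite sqr_sqrtr// mulr_ge0// addr_ge0.
rewrite /gauss_kernel; suff -> : n%:R * m * P ^+ 2 = (m ^+ 2 - r ^+ 2) * P ^+ 2 by ring.
by rewrite r2; ring.
Qed.

Lemma lt_sqrt_threshold : (0 < n)%N -> 0 < m - r.
Proof.
move=> n0; have m2 : 2 < m by rewrite ltrDr ltr0n.
have m0 : 0 < m by lra.
by rewrite subr_gt0 -[ltRHS](gtr0_norm m0) -sqrtr_sqr ltr_sqrt ?exprn_gt0// expr2 ltr_pM2r.
Qed.

Lemma gauss_prob2_ge0 A P : measurable A -> 0 < P ->
  (forall x, A x -> 0 <= gauss_kernel P x) -> 0 <= gauss_prob2 A P.
Proof.
move=> mA P0 k0; rewrite gauss_prob2_kernel// mulr_ge0 ?mulr_ge0 ?powR_ge0//.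
by apply: Rintegral_ge0 => x Ax; rewrite mulr_ge0 ?k0 ?radial_gauss_ge0.
Qed.

Lemma gauss_prob2_gt0 A P : measurable A -> 0 < P -> lebesgue_rV n A != 0%E ->
  (forall x, A x -> 0 < gauss_kernel P x) -> 0 < gauss_prob2 A P.
Proof.
move=> mA P0 A0 k0; have P20 : 0 < (2 * P)^-1 by rewrite invr_gt0 mulr_gt0.
rewrite gauss_prob2_kernel// mulr_gt0//.
  by rewrite mulr_gt0 ?powR_gt0// divr_gt0// powR_gt0// mulr_gt0// pi_gt0.
apply: Rintegral_gt0 => //; first exact: integrable_gauss_kernel.
by move=> x Ax; rewrite mulr_gt0 ?k0// /radial_gauss expr0 mul1r expR_gt0.
Qed.

Lemma gauss_prob2_termE A P : 0 < P -> gauss_prob2 A P = (2 * pi) `^ (- nu) / 4 *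
  (gauss_term A (- nu - 4) 2 P + (- (2 * m) * gauss_term A (- nu - 3) 1 P +
    n%:R * m * gauss_term A (- nu - 2) 0 P)).
Proof.
move=> P0; rewrite /gauss_prob2.
rewrite (@gauss_term_shift _ _ _ (- nu - 4) (- nu - 2) _ 2)//; last by ring.
rewrite (@gauss_term_shift _ _ _ (- nu - 4) (- nu - 3) _ 1)//; last by ring.
by rewrite /gauss_term; ring.
Qed.

Lemma derivable_gauss_prob2 A P : measurable A -> 0 < P ->
  exists d, is_derive P 1 (gauss_prob2 A) d.
Proof.
move=> mA P0.
have d0 := is_derive_gauss_term (- nu - 2) 0 mA P0.
have d1 := is_derive_gauss_term (- nu - 3) 1 mA P0.
have d2 := is_derive_gauss_term (- nu - 4) 2 mA P0.
have := is_derive1Z ((2 * pi) `^ (- nu) / 4)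
  (is_derive1D d2 (is_derive1D (is_derive1Z (- (2 * m)) d1) (is_derive1Z (n%:R * m) d0))).
move=> d; eexists; apply: is_derive_near d; near=> Q; apply/esym/gauss_prob2_termE.
by near: Q; exact: lt_nbhsr.
Unshelve. all: by end_near. Qed.

(** The second derivative in the variable [t = (2 * P)^-1], up to a positive factor: a combination
    of moments with polynomial coefficients, hence analytic. *)
Definition gauss_series A t : R := t * (t * radial_moment A 2 t) +
  (- m * (t * radial_moment A 1 t) + n%:R * m / 4 * radial_moment A 0 t).

Lemma has_power_series_gauss_series A t : measurable A -> 0 < t ->
  has_power_series (gauss_series A) t.
Proof.
move=> mA t0; have ps k : has_power_series (radial_moment A k) t.
  eexists => h ht; exact: radial_moment_power_series.
apply: has_power_seriesD; first by do 2 apply: has_power_series_mulX.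
apply: has_power_seriesD; apply: has_power_seriesZ => //.
exact: has_power_series_mulX.
Qed.

Lemma gauss_prob2_series A P : 0 < P -> gauss_prob2 A P =
  (2 * pi) `^ (- nu) * P `^ (- nu - 4) * P ^+ 2 * gauss_series A (2 * P)^-1.
Proof. by move=> P0; rewrite /gauss_prob2 /gauss_series; field; rewrite gt_eqF. Qed.

Lemma gauss_prob2_isolated_zero A P Q : measurable A -> 0 < P -> 0 < Q ->
  gauss_prob2 A Q != 0 ->
  exists2 d, 0 < d & forall u, 0 < `|u - P| < d -> 0 < u /\ gauss_prob2 A u != 0.
Proof.
move=> mA P0 Q0 AQ; have inv0 (u : R) : 0 < u -> 0 < (2 * u)^-1.
  by move=> u0; rewrite invr_gt0 mulr_gt0.
have [|d d0 dG] := has_power_series_isolated_zero (inv0 _ P0) (inv0 _ Q0) _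
    (fun u u0 => has_power_series_gauss_series mA u0).
  by move: AQ; rewrite gauss_prob2_series// mulf_eq0 negb_or => /andP[].
(* Staying above [P / 2] bounds the distance of [(2 * u)^-1] from [(2 * P)^-1] by
   [|u - P| / P ^+ 2]; the other term makes this less than [d]. *)
exists (Num.min (P / 2) (d * P ^+ 2)) => [|u].
  by rewrite lt_min divr_gt0//= mulr_gt0// exprn_gt0.
move=> /andP[uP]; rewrite lt_min => /andP[uP2 udP].
have u2 : P / 2 < u by move: uP2; rewrite ltr_norml; lra.
have u0 : 0 < u by lra.
split => //; rewrite gauss_prob2_series// mulf_neq0//.
  by rewrite gt_eqF// !mulr_gt0 ?powR_gt0 ?exprn_gt0// mulr_gt0// pi_gt0.
apply: dG; rewrite (_ : _ - _ = (P - u) / (2 * u * P)); last first.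
  by field; rewrite !gt_eqF.
have uP0 : 0 < 2 * u * P by rewrite !mulr_gt0.
rewrite normf_div (gtr0_norm uP0) distrC divr_gt0//=.
rewrite ltr_pdivrMr//; apply: lt_le_trans udP _.
rewrite ler_wpM2l ?(ltW d0)// expr2 ler_wpM2r ?(ltW P0)//; lra.
Qed.

End second_derivative.

(** * Derivatives and inflection points of the error probability *)

Section error_probability.
Context {R : realType} {n M : nat}.
Variables (s : 'I_M -> 'rV[R]_n) (i : 'I_M).
Hypotheses (n_gt0 : (0 < n)%N) (hs : constellation s).
Implicit Types (P Q l u : R).
Local Notation Omega := (decision_region s i).
Local Notation m := (n%:R + 2 : R).
Local Notation r := (Num.sqrt (2 * m) : R).

Let mOmega : measurable Omega := measurable_decision_region i hs.

Let mr0 : 0 < m - r := lt_sqrt_threshold n_gt0.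

Let mr1 : 0 < m + r.
Proof. by have : 0 <= r := sqrtr_ge0 _; have := mr0; lra. Qed.

Lemma lower_threshold_gt0 : 0 < lower_threshold s i.
Proof. by rewrite divr_gt0// exprn_gt0// dmin_gt0. Qed.

(** The contributions of the region and of its complement cancel. On the complement [dot x x]
    exceeds the larger root of the kernel, and strictness holds because the complement contains a
    half-space of nonzero measure. *)
Lemma gauss_prob2_lt0 P : 0 < P -> P <= lower_threshold s i -> gauss_prob2 Omega P < 0.
Proof.
move=> P0; rewrite ler_pdivlMr// => Pl.
have mC : measurable (~` Omega) by exact: measurableC.
have : gauss_prob2 (Omega `|` ~` Omega) P = 0 by rewrite setUv gauss_prob2_setT.
rewrite gauss_prob2U ?setICr// => /eqP; rewrite addr_eq0 => /eqP ->.
rewrite oppr_lt0; apply: gauss_prob2_gt0 => //; last first.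
  move=> x /(dmin_lt_notin hs) dx.
  have : 0 <= r * P by rewrite mulr_ge0 ?sqrtr_ge0// ltW.
  by move=> rP; rewrite gauss_kernelE mulr_gt0//; lra.
have [j ji] := exists_neighbour i hs.
have a0 : facet_normal s i j != 0.
  by rewrite -dotxx_eq0 (dot_facet_normal hs)// oner_eq0.
apply: contra (halfspace_measure_neq0 (facet_dist s i j) a0) => /eqP C0.
rewrite -measure_le0 -C0 le_measure ?inE//; last first.
  by move=> x /= bx /(_ j ji); rewrite leNgt bx.
rewrite (_ : [set x | _] = ~` [set x | dot (facet_normal s i j) x <= facet_dist s i j]).
  by apply: measurableC; exact: measurable_dot_le.
by apply/seteqP; split => x /=; rewrite ltNge => /negP.
Qed.

(** If [dmax] is finite, it bounds the norm on the region; if it is infinite, so is the threshold,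
    which no real [P] reaches. *)
Lemma dot_le_threshold P (x : 'rV[R]_n) : 0 < P -> (upper_threshold s i <= P%:E)%E ->
  Omega x -> dot x x <= (m - r) * P.
Proof.
move=> P0 UP Dx; have [->|x0] := eqVneq x 0.
  by rewrite /dot big1 ?mulr_ge0 ?(ltW mr0) ?(ltW P0)// => k _; rewrite mxE mul0r.
have [bD|nbD] := pselect (bounded_set Omega); last first.
  move: UP; rewrite /upper_threshold /dmax; case: asboolP => // _.
  by rewrite expe2 mulyy gt0_mulye ?lte_fin ?invr_gt0.
have := enorm_le_dmax hs bD Dx x0; move: UP; rewrite /upper_threshold.
case: (dmax s i) => [d||//].
  rewrite expe2 -!EFinM !lee_fin ler_pdivrMr// => dP xd.
  rewrite -sqr_enorm mulrC (le_trans _ dP)// -expr2 ler_sqr// nnegrE ?enorm_ge0//.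
  by rewrite (le_trans _ xd)// enorm_ge0.
by rewrite expe2 mulyy gt0_mulye ?lte_fin ?invr_gt0.
Qed.

Lemma gauss_prob2_ge0_upper P : 0 < P -> (upper_threshold s i <= P%:E)%E ->
  0 <= gauss_prob2 Omega P.
Proof.
move=> P0 UP; apply: gauss_prob2_ge0 => // x Dx.
have h := dot_le_threshold P0 UP Dx.
have : 0 <= r * P by rewrite mulr_ge0 ?sqrtr_ge0// ltW.
by move=> rP; rewrite gauss_kernelE mulr_le0//; lra.
Qed.

Lemma is_derive_error_prob P : 0 < P ->
  is_derive P 1 (error_prob s i) (- gauss_prob1 Omega P).
Proof.
move=> P0; have := is_derive1D (is_derive_cst (1 : R) P (1 : R))
  (is_derive1Z (-1) (is_derive_gauss_prob mOmega P0)).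
rewrite add0r mulN1r; apply: is_derive_near; near=> Q.
by rewrite mulN1r.
Unshelve. all: by end_near. Qed.

Lemma is_derive_error_prob1 P : 0 < P ->
  is_derive P 1 (fun Q => - gauss_prob1 Omega Q) (- gauss_prob2 Omega P).
Proof.
move=> P0; have := is_derive1Z (-1) (is_derive_gauss_prob1 mOmega P0).
rewrite mulN1r; apply: is_derive_near; near=> Q.
by rewrite mulN1r.
Unshelve. all: by end_near. Qed.

Local Notation f := (error_prob s i).
Local Notation f2 := (derive1n 2 f).

Lemma derive1_error_prob P : 0 < P -> derive1 f P = - gauss_prob1 Omega P.
Proof. by move=> P0; rewrite derive1E; have [_ ->] := is_derive_error_prob P0. Qed.

Lemma is_derive_derive1_error_prob P : 0 < P ->
  is_derive P 1 (derive1 f) (- gauss_prob2 Omega P).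
Proof.
move=> P0; apply: is_derive_near (is_derive_error_prob1 P0); near=> Q.
by apply/esym/derive1_error_prob; near: Q; exact: lt_nbhsr.
Unshelve. all: by end_near. Qed.

Lemma derive1n2_error_prob P : 0 < P -> f2 P = - gauss_prob2 Omega P.
Proof.
by move=> P0; rewrite /= derive1E; have [_ ->] := is_derive_derive1_error_prob P0.
Qed.

Lemma continuous_derive1n2_error_prob P : 0 < P -> {for P, continuous f2}.
Proof.
move=> P0; have [d Dd] := derivable_gauss_prob2 mOmega P0.
suff D : is_derive P 1 f2 (-1 * d) by exact: is_derive_continuous D.
apply: is_derive_near (is_derive1Z (-1) Dd); near=> Q.
rewrite mulN1r; apply/esym/derive1n2_error_prob.
by near: Q; exact: lt_nbhsr.
Unshelve. all: by end_near. Qed.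

Lemma inflection_pointE P : 0 < P -> inflection_point f P <-> f2 P = 0 /\ sign_change f2 P.
Proof.
move=> P0; split=> [[]//|[f0 sc]]; split => //; near=> Q.
have Q0 : 0 < Q by near: Q; exact: lt_nbhsr.
by have [] := is_derive_error_prob Q0; have [] := is_derive_derive1_error_prob Q0.
Unshelve. all: by end_near. Qed.

(** Excludes inflection points where the second derivative is only known to be nonpositive. *)
Lemma not_sign_change (g : R -> R) (P : R) :
  (\forall Q \near P, g Q <= 0) \/ (\forall Q \near P, 0 <= g Q) -> ~ sign_change g P.
Proof.
have exl (A B : set R) : (\forall Q \near P, A Q) -> (\forall Q \near P^'-, B Q) ->
    exists Q, A Q /\ B Q.
  by move=> nA nB; apply: (@filter_ex _ P^'-); apply: filterI => //; exact: cvg_within nA.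
have exr (A B : set R) : (\forall Q \near P, A Q) -> (\forall Q \near P^'+, B Q) ->
    exists Q, A Q /\ B Q.
  by move=> nA nB; apply: (@filter_ex _ P^'+); apply: filterI => //; exact: cvg_within nA.
move=> [] side [[gl gr]|[gl gr]].
- by have [Q [gQ]] := exr _ _ side gr; rewrite ltNge gQ.
- by have [Q [gQ]] := exl _ _ side gl; rewrite ltNge gQ.
- by have [Q [gQ]] := exl _ _ side gl; rewrite ltNge gQ.
- by have [Q [gQ]] := exr _ _ side gr; rewrite ltNge gQ.
Qed.

End error_probability.

Theorem theorem5 (R : realType) (n M : nat) (hn : (1 <= n)%N)
    (s : 'I_M -> 'rV[R]_n) (hs : constellation s) (i : 'I_M) :
  [/\ concave_on [set P | 0 < P /\ (upper_threshold s i <= P%:E)%E]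
        (error_prob s i),
      convex_on [set P | 0 < P /\ P <= lower_threshold s i]
        (error_prob s i) &
      odd_card [set P | [/\ 0 < P, lower_threshold s i <= P,
                            (P%:E <= upper_threshold s i)%E &
                            inflection_point (error_prob s i) P]]].
Proof.
set l := lower_threshold s i; have l0 : 0 < l by exact: lower_threshold_gt0.
have mO := measurable_decision_region i hs.
have M0 : (0 < M)%N by case: hs => M2 _ _; exact: ltnW.
split.
(* The opposite of the error probability has the same derivatives as the probability of correct
   detection. *)
- apply: (convex_on_derive2_ge0 (f1 := gauss_prob1 (decision_region s i))
    (f2 := gauss_prob2 (decision_region s i))).
  + move=> x y z [x0 xU] [y0 yU] /andP[xz zy]; split; first exact: lt_le_trans xz.
    by rewrite (le_trans xU)// lee_fin.
  + move=> P [P0 _]; have := is_derive1Z (-1) (is_derive_error_prob i hs P0).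
    rewrite mulrNN mul1r; apply: is_derive_near; near=> Q.
    by rewrite mulN1r.
  + by move=> P [P0 _]; exact: is_derive_gauss_prob1.
  + by move=> P [P0 PU]; exact: gauss_prob2_ge0_upper.
- apply: (convex_on_derive2_ge0 (f1 := fun P => - gauss_prob1 (decision_region s i) P)
    (f2 := fun P => - gauss_prob2 (decision_region s i) P)).
  + move=> x y z [x0 xl] [y0 yl] /andP[xz zy]; split; first exact: lt_le_trans xz.
    exact: le_trans yl.
  + by move=> P [P0 _]; exact: is_derive_error_prob.
  + by move=> P [P0 _]; exact: is_derive_error_prob1.
  + by move=> P [P0 Pl]; rewrite oppr_ge0 ltW// gauss_prob2_lt0.
- set f2 := derive1n 2 (error_prob s i).
  have f2E P : 0 < P -> f2 P = - gauss_prob2 (decision_region s i) P.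
    by move=> P0; exact: derive1n2_error_prob.
  have f2l P : 0 < P -> P <= l -> 0 < f2 P.
    by move=> P0 Pl; rewrite f2E// oppr_gt0 gauss_prob2_lt0.
  have f2U P : 0 < P -> (upper_threshold s i <= P%:E)%E -> f2 P <= 0.
    by move=> P0 PU; rewrite f2E// oppr_le0 gauss_prob2_ge0_upper.
  have [U U0 f2inf] : exists2 U, 0 < U & forall P, U <= P -> f2 P <= 0.
    have [U U0 HU] := gauss_prob2_polyhedron_large (facet_form s i) M0.
    exists U => // P UP; rewrite f2E ?(lt_le_trans U0)// oppr_le0.
    by rewrite (decision_regionE i hs); exact: HU.
  have isolated P : 0 < P -> exists2 d, 0 < d &
      forall u, 0 < `|u - P| < d -> 0 < u /\ f2 u != 0.
    move=> P0; have gl : gauss_prob2 (decision_region s i) l != 0.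
      by rewrite lt_eqF// gauss_prob2_lt0.
    have [d d0 dP] := gauss_prob2_isolated_zero mO P0 l0 gl.
    by exists d => // u /dP[u0 fu]; rewrite f2E// oppr_eq0.
  (* Beyond [U] only [f2 <= 0] is known; since zeros are isolated, [f2] is nonzero just to the right
     of [V], hence negative. *)
  have [u [lu Uu fu]] : exists u, [/\ l < u, U <= u & f2 u < 0].
    pose V := U + l; have V0 : 0 < V by rewrite addr_gt0.
    have [d d0 dV] := isolated V V0; exists (V + d / 2).
    have UV : U <= V + d / 2 by rewrite /V; lra.
    split => //; first by rewrite /V; lra.
    rewrite lt_neqAle f2inf// andbT.
    by have [] // := dV (V + d / 2); rewrite addrAC subrr add0r gtr0_norm; lra.
  (* The possibly infinite upper threshold is traded for [u]: beyond either bound [f2 <= 0], so no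
     sign change occurs there. *)
  rewrite (_ : [set P | _] = [set p | [/\ l <= p <= u, f2 p = 0 & sign_change f2 p]]).
    apply: odd_sign_changes => //; first exact: ltW.
    - exact: f2l.
    - by move=> x /andP[lx _]; apply: continuous_derive1n2_error_prob => //; exact: lt_le_trans lx.
    - apply: finite_isolated => x /andP[lx _].
      have [d d0 dx] := isolated x (lt_le_trans l0 lx).
      by exists d => // y /dx[_ /eqP].
  apply/seteqP; split => [P [P0 lP PU /(inflection_pointE i hs P0)[fP sc]]|
                          P [/andP[lP Pu] fP sc]].
    split => //; rewrite lP leNgt; apply/negP => uP.
    apply: (not_sign_change _ sc); left; near=> Q; apply: f2inf.
    by rewrite (le_trans Uu)// ltW//; near: Q; exact: lt_nbhsr.
  have P0 : 0 < P by exact: lt_le_trans lP.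
  split => //; last exact/(inflection_pointE i hs P0).
  rewrite leNgt; apply/negP => UP.
  apply: (not_sign_change _ sc); left.
  (* Nothing lies above [+oo]; there remain a finite threshold and the formal value [-oo], for which
     [f2U] applies to every positive [Q]. *)
  case: (upper_threshold s i) f2U UP => [v||] f2U; rewrite ?lte_fin ?ltNyr// => UP.
  + near=> Q; apply: f2U; first by near: Q; exact: lt_nbhsr.
    by rewrite lee_fin ltW//; near: Q; exact: lt_nbhsr.
  + near=> Q; apply: f2U; last exact: leNye.
    by near: Q; exact: lt_nbhsr.
Unshelve. all: by end_near. Qed.
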